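(* Let Assumptions $\mathcal{A}_1$ and $\mathcal{A}_2$ (stated in the context) hold for the approximating Markov chain $(Y^h_n)_{n=0,\dots,N}$, and assume that $u\in C^4_{\mathrm{pol},T}(\mathcal{D})$, where $u(t,y)=\mathbb{E}[f(Y^{t,y}_T)]$. Then there exist $\bar h>0$ and $C>0$ such that for every $h<\bar h$ one has $$\left|\mathbb{E}[f(Y^h_N)]-\mathbb{E}[f(Y_T)]\right|\leq CTh.$$
   Context: Let $d\in\mathbb{N}^*$ and let $\mathcal{D}\subseteq\mathbb{R}^d$ be a convex domain or the closure of one. Let $Y$ be a $d$-dimensional diffusion $dY_t=\mu_Y(Y_t)dt+\sigma_Y(Y_t)dW_t$, $Y_0\in\mathcal{D}$, with $W$ an $\ell$-dimensional Brownian motion; $a_Y=\sigma_Y\sigma_Y^\star$ ($\star$ = transpose), with generator $\mathcal{A}=\frac12\mathrm{Tr}(a_YD^2_y)+\mu_Y\cdot\nabla_y$. Fix $T>0$, $f:\mathcal{D}\to\mathbb{R}$ and let $Y^{t,y}$ be the solution starting from $y$ at time $t$, $u(t,y)=\mathbb{E}[f(Y^{t,y}_T)]$ on $[0,T]\times\mathcal{D}$. Standing assumptions: (a) $\mu_Y$ has polynomial growth; (b) for every $(t,y)\in[0,T]\times\mathcal{D}$ there is a unique weak solution $(Y^{t,y}_s)_{s\in[t,T]}$ and $\mathbb{P}(Y^{t,y}_s\in\mathcal{D}\ \forall s\in[t,T])=1$; (c) $u$ solves $\partial_tu+\mathcal{A}u=0$ in $[0,T)\times\mathcal{D}$, $u(T,\cdot)=f$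 in $\mathcal{D}$. For $N\in\mathbb{N}^*$, $h=T/N$, $(Y^h_n)_{n=0,\dots,N}$ is a Markov chain with state space $\mathcal{Y}^h_n\subset\mathcal{D}$ at step $n$ and $Y^h_0=Y_0$. $\|\cdot\|_p$ is the norm of $L^p(\Omega)$. Space: $C^q_{\mathrm{pol},T}(\mathcal{D})$ is the set of $v=v(t,y)$ in $C^{\lfloor q/2\rfloor,q}([0,T)\times\mathcal{D})$ for which there are $C,c>0$ with $\sup_{t\in[0,T)}|\partial^k_t\partial^l_yv(t,y)|\leq C(1+|y|^c)$ for all $y\in\mathcal{D}$ and all $k\in\mathbb{N}$, $l\in\mathbb{N}^d$ with $2k+|l|\leq q$. Assumption $\mathcal{A}_1$: there exists $\bar h>0$ such that for every $h<\bar h$ (and every $n$) $\mathbb{E}[Y^h_{n+1}-Y^h_n\mid Y^h_n]=\mu_Y(Y^h_n)h+f_h(Y^h_n)$, $\mathbb{E}[(Y^h_{n+1}-Y^h_n)(Y^h_{n+1}-Y^h_n)^\star\mid Y^h_n]=a_Y(Y^h_n)h+g_h(Y^h_n)$, $\mathbb{E}[(Y^h_{n+1}-Y^h_n)^l\mid Y^h_n]=j_{h,l}(Y^h_n)$ for every $l\in\mathbb{N}^d$ with $|l|=3$ (here $z^l=z_1^{l_1}\cdots z_d^{l_d}$), where $f_h:\mathcal{D}\to\mathbb{R}^d$, $g_h:\mathcal{D}\to\mathbb{R}^{d\times d}$, $j_{h,l}:\mathcal{D}\to\mathbb{R}$ are such that there exist $p>1$, $C>0$ with, for all $h\leq\bar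 h$ and all $n=0,\dots,N$, $\|f_h(Y^h_n)\|_p\leq Ch^2$, $\|g_h(Y^h_n)\|_p\leq Ch^2$, $\|j_{h,l}(Y^h_n)\|_p\leq Ch^2$ ($|l|=3$). Assumption $\mathcal{A}_2$: there exists $\bar h>0$ such that for every $p>1$ there is $C_p>0$ with $\sup_{h<\bar h}\sup_{0\leq n\leq N}\|Y^h_n\|_p\leq C_p$ and $\sup_{h<\bar h}\sup_{0\leq n\leq N-1}\frac1{\sqrt h}\|Y^h_{n+1}-Y^h_n\|_p\leq C_p$.
   Formalization: The formal theorem also assumes that u(t,y) tends to f(y) as t increases to T for each y in the domain; with only u(T,.)=f the claim fails, e.g. for Brownian motion, f the indicator of {0} and a symmetric random walk. *)

(* Defs.v *)
From HB Require Import structures.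
From mathcomp Require Import all_boot all_order all_algebra.
Set Warnings "-notation-overridden,-notation-incompatible-prefix".
From mathcomp Require Import all_classical all_reals all_analysis.

Set Implicit Arguments.
Unset Strict Implicit.
Unset Printing Implicit Defensive.
Import Order.TTheory GRing.Theory Num.Theory.
Import numFieldNormedType.Exports.
Local Open Scope classical_set_scope.
Local Open Scope ring_scope.

(* Points of R^d are column vectors ['cV[R]_d].  A function on a subset D of R^d
   is a total function of which only the values on D matter. *)

Section EuclideanSpace.
Variable R : realType.

(* Euclidean (Frobenius) norm; the norm [`|x|] of the library on matrices is
   the sup norm. *)
Definition enorm m n (A : 'M[R]_(m, n)) : R :=
  Num.sqrt (\sum_i \sum_j A i j ^+ 2).

Definition borel d : set (set 'cV[R]_d) := <<s @open 'cV[R]_d >>.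

Definition borel_on d (D : set 'cV[R]_d) (g : 'cV[R]_d -> R) : Prop :=
  forall B : set R, measurable B -> borel (D `&` g @^-1` B).

Definition convex_domain d (O : set 'cV[R]_d) : Prop :=
  [/\ O !=set0, open O & convex_set (O : set (convex_lmodType 'cV[R]_d))].

Definition convex_domain_or_closure d (D : set 'cV[R]_d) : Prop :=
  exists2 O, convex_domain O & D = O \/ D = closure O.

Definition multi_index d := {ffun 'I_d -> nat}.
Definition mdeg d (l : multi_index d) : nat := (\sum_i l i)%N.
Definition mindex0 d : multi_index d := [ffun=> 0%N].
Definition mincr d (l : multi_index d) (i : 'I_d) : multi_index d :=
  [ffun j => (l j + (j == i))%N].
Definition mpow d (z : 'cV[R]_d) (l : multi_index d) : R :=
  \prod_i z i 0 ^+ l i.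

End EuclideanSpace.

Section ParabolicRegularity.
Variables (R : realType) (d : nat) (T : R) (D : set 'cV[R]_d).

(* [dv k l] is the derivative d_t^k d_y^l v for 2k + |l| <= q.  As D may contain
   boundary points (and t = 0 is an endpoint), v is of class C^{floor(q/2),q} on
   [0,T) x D when these derivatives exist in the interior and extend
   continuously to [0,T) x D.  Since D is contained in the closure of its
   interior, the extensions are determined by v. *)
Definition pderivs (q : nat) (v : R -> 'cV[R]_d -> R)
    (dv : nat -> multi_index d -> R -> 'cV[R]_d -> R) : Prop :=
  [/\ forall (t : R) y, 0 <= t < T -> D y -> dv 0%N (mindex0 d) t y = v t y,
      forall k l, (2 * k + mdeg l <= q)%N ->
        {within [set z : R * 'cV[R]_d | 0 <= z.1 < T /\ D z.2],
          continuous (fun z => dv k l z.1 z.2)},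
      forall k l (t : R) y, (2 * k.+1 + mdeg l <= q)%N -> 0 < t < T -> D° y ->
        is_derive t (1 : R) (fun s => dv k l s y) (dv k.+1 l t y)
    & forall k l i (t : R) y, (2 * k + (mdeg l).+1 <= q)%N -> 0 < t < T -> D° y ->
        is_derive y (delta_mx i 0 : 'cV[R]_d) (dv k l t)
          (dv k (mincr l i) t y)].

Definition C_pol (q : nat) (v : R -> 'cV[R]_d -> R) : Prop :=
  exists2 dv, pderivs q v dv &
  exists C c : R, [/\ 0 < C, 0 < c &
    forall k l, (2 * k + mdeg l <= q)%N ->
    forall (t : R) y, 0 <= t < T -> D y -> `|dv k l t y| <= C * (1 + enorm y `^ c)].

Definition poly_growth m n (g : 'cV[R]_d -> 'M[R]_(m, n)) : Prop :=
  exists C c : R, [/\ 0 < C, 0 < c &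
    forall y, D y -> enorm (g y) <= C * (1 + enorm y `^ c)].

End ParabolicRegularity.

Section Generator.
Variables (R : realType) (d l : nat).
Variables (mu : 'cV[R]_d -> 'cV[R]_d) (sigma : 'cV[R]_d -> 'M[R]_(d, l)).

Definition diffusion_mx (y : 'cV[R]_d) : 'M[R]_d := sigma y *m (sigma y)^T.

Definition gradient (dv : nat -> multi_index d -> R -> 'cV[R]_d -> R) t y
  : 'cV[R]_d := \col_i dv 0%N (mincr (mindex0 d) i) t y.

Definition hessian (dv : nat -> multi_index d -> R -> 'cV[R]_d -> R) t y
  : 'M[R]_d := \matrix_(i, j) dv 0%N (mincr (mincr (mindex0 d) i) j) t y.

Definition generator (dv : nat -> multi_index d -> R -> 'cV[R]_d -> R) t y : R :=
  2^-1 * \tr (diffusion_mx y *m hessian dv t y)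
  + ((mu y)^T *m gradient dv t y) 0 0.

(* Classical solution of the terminal value problem.  The terminal value is
   attained in the limit t -> T-: for u(t,y) = E[f(Y^{t,y}_T)] the equality
   u(T,y) = f(y) alone is void. *)
Definition solves_terminal_problem (T : R) (D : set 'cV[R]_d)
    (f : 'cV[R]_d -> R) (u : R -> 'cV[R]_d -> R) : Prop :=
  (exists2 du, pderivs T D 2 u du &
     forall (t : R) y, 0 <= t < T -> D y ->
       du 1%N (mindex0 d) t y + generator du t y = 0)
  /\ forall y, D y -> u T y = f y /\ u t y @[t --> T^'-] --> f y.

End Generator.

Section StochasticBasis.
Variables (R : realType) (disp : measure_display) (Om : measurableType disp).
Variable P : probability Om R.
Implicit Types (F : R -> set (set Om)) (a b t : R).

(* Filtration indexed by [0,+oo), satisfying the usual conditions. *)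
Definition usual_filtration F : Prop :=
  [/\ forall t : R, 0 <= t -> sigma_algebra setT (F t) /\ F t `<=` measurable,
      forall s t : R, 0 <= s -> s <= t -> F s `<=` F t,
      P.-negligible `<=` F 0
    & forall t : R, 0 <= t -> \bigcap_(s in [set s | t < s]) F s `<=` F t].

Definition adapted_on F (I : set R) n (X : R -> Om -> 'cV[R]_n) : Prop :=
  forall t, I t -> forall B, borel B -> F t (X t @^-1` B).

(* Standard n-dimensional Brownian motion relative to F.  The last condition
   says at once that W_t - W_s is independent of F_s and that its coordinates
   are independent with law N(0, t - s); the second argument of [normal_prob]
   is the standard deviation. *)
Definition brownian_motion F n (W : R -> Om -> 'cV[R]_n) : Prop :=
  [/\ {ae P, forall w, W 0 w = 0},
      forall w, {within `[0, +oo[, continuous (W ^~ w)},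
      adapted_on F `[0, +oo[ W
    & forall s t : R, 0 <= s -> s < t -> forall A, F s A ->
      forall B : 'I_n -> set R, (forall i, measurable (B i)) ->
      (P (A `&` \bigcap_i [set w | B i (W t w i 0 - W s w i 0)%R]) =
       P A * \prod_(i < n) normal_prob 0 (Num.sqrt (t - s)) (B i))%E].

Definition cvg_in_probability_to0 (X : nat -> Om -> \bar R) : Prop :=
  forall e : R, 0 < e ->
    P [set w | (e%:E <= X n w)%E] @[n --> \oo] --> (0 : \bar R).

Record simple_process := SimpleProcess {
  sp_size : nat;
  sp_time : nat -> R;
  sp_coef : nat -> Om -> R }.

Definition is_simple_process F a b (S : simple_process) : Prop :=
  [/\ sp_time S 0%N = a, sp_time S (sp_size S) = b,
      forall k, (k < sp_size S)%N -> sp_time S k <= sp_time S k.+1,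
      forall k, (k < sp_size S)%N -> exists M : R, forall w, `|sp_coef S k w| <= M
    & forall k, (k < sp_size S)%N -> forall B : set R, measurable B ->
        F (sp_time S k) (sp_coef S k @^-1` B)].

Definition sp_val (S : simple_process) (r : R) (w : Om) : R :=
  \sum_(k < sp_size S)
    sp_coef S k w * \1_(`]sp_time S k, sp_time S k.+1] : set R) r.

Definition sp_integral (S : simple_process) (B : R -> Om -> R) (w : Om) : R :=
  \sum_(k < sp_size S)
    sp_coef S k w * (B (sp_time S k.+1) w - B (sp_time S k) w).

(* I is (a version of) the Ito integral of H over [a,b] against the real
   Brownian motion B: the limit in probability of the integrals of simple
   processes S_n with int_a^b |S_n - H|^2 dr -> 0 in probability. *)
Definition is_ito_integral F (B : R -> Om -> R) a b (H : R -> Om -> R)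
    (I : Om -> R) : Prop :=
  measurable_fun setT I /\
  exists S : nat -> simple_process,
    [/\ forall n, is_simple_process F a b (S n),
        cvg_in_probability_to0 (fun n w =>
          \int[lebesgue_measure]_(r in `[a, b])
            ((sp_val (S n) r w - H r w) ^+ 2)%:E)%E
      & cvg_in_probability_to0 (fun n w =>
          (`|sp_integral (S n) B w - I w|)%:E)].

End StochasticBasis.

Section WeakSolution.
Variables (R : realType) (d l : nat).

(* A process Y on a filtered probability space carrying W. *)
Record sde_system := SdeSystem {
  sde_disp : measure_display;
  sde_space : measurableType sde_disp;
  sde_prob : probability sde_space R;
  sde_filt : R -> set (set sde_space);
  sde_W : R -> sde_space -> 'cV[R]_l;
  sde_Y : R -> sde_space -> 'cV[R]_d }.
Arguments sde_filt s _ _ : clear implicits.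
Arguments sde_W s _ _ : clear implicits.
Arguments sde_Y s _ _ : clear implicits.

Variables (T : R) (D : set 'cV[R]_d).
Variables (mu : 'cV[R]_d -> 'cV[R]_d) (sigma : 'cV[R]_d -> 'M[R]_(d, l)).

(* Weak solution on [t,T], started from y at time t, of
   dY = mu(Y) ds + sigma(Y) dW.  As mu and sigma live on D, a solution stays in
   D almost surely. *)
Definition weak_solution (t : R) (y : 'cV[R]_d) (X : sde_system) : Prop :=
  let P := sde_prob X in
  let F := sde_filt X in
  let W := sde_W X in
  let Y := sde_Y X in
  [/\ usual_filtration P F /\ brownian_motion P F W,
      adapted_on F `[t, T] Y /\ forall w, {within `[t, T], continuous (Y ^~ w)},
      {ae P, forall w, forall s : R, t <= s <= T -> D (Y s w)},
      {ae P, forall w, forall i j,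
         (\int[lebesgue_measure]_(r in `[t, T]) `|mu (Y r w) i 0|%:E < +oo)%E /\
         (\int[lebesgue_measure]_(r in `[t, T])
            ((sigma (Y r w) i j) ^+ 2)%:E < +oo)%E}
    & exists I : 'I_d -> 'I_l -> R -> sde_space X -> R,
      forall s : R, t <= s <= T ->
        (forall i j, is_ito_integral P F (fun r w => W r w j 0) t s
                       (fun r w => sigma (Y r w) i j) (I i j s)) /\
        {ae P, forall w, forall i, Y s w i 0 = y i 0
           + \int[lebesgue_measure]_(r in `[t, s]) (mu (Y r w) i 0)
           + \sum_j I i j s w}].

(* Equality of the finite-dimensional distributions on [t,T], i.e. of the laws
   on the space of continuous paths. *)
Definition same_law (t : R) (X X' : sde_system) : Prop :=
  forall m (s : 'I_m -> R) (B : 'I_m -> set 'cV[R]_d),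
    (forall k, t <= s k <= T) -> (forall k, borel (B k)) ->
    sde_prob X (\bigcap_k (sde_Y X (s k) @^-1` B k)) =
    sde_prob X' (\bigcap_k (sde_Y X' (s k) @^-1` B k)).

Definition value_function (f : 'cV[R]_d -> R)
    (X : R -> 'cV[R]_d -> sde_system) (t : R) (y : 'cV[R]_d) : R :=
  fine 'E_(sde_prob (X t y))[(fun w => f (sde_Y (X t y) T w))].

End WeakSolution.

Arguments sde_filt {R d l} s _ _.
Arguments sde_W {R d l} s _ _.
Arguments sde_Y {R d l} s _ _.

Section MarkovChain.
Variables (R : realType) (d : nat).

(* A discrete-time process on its own probability space. *)
Record chain := Chain {
  ch_disp : measure_display;
  ch_space : measurableType ch_disp;
  ch_prob : probability ch_space R;
  ch_Y : nat -> ch_space -> 'cV[R]_d }.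
Arguments ch_Y : clear implicits.

(* Z is a version of E[X | G]. *)
Definition is_condexp disp (Om : measurableType disp) (P : probability Om R)
    (G : set (set Om)) (X Z : Om -> R) : Prop :=
  [/\ P.-integrable setT (EFin \o X), P.-integrable setT (EFin \o Z),
      forall B : set R, measurable B -> G (Z @^-1` B)
    & forall A, G A ->
        (\int[P]_(w in A) (X w)%:E = \int[P]_(w in A) (Z w)%:E)%E].

Definition sigma_of (Om : Type) (X : Om -> 'cV[R]_d) : set (set Om) :=
  [set X @^-1` B | B in @borel R d].

Definition sigma_upto (Om : Type) (X : nat -> Om -> 'cV[R]_d) (n : nat)
  : set (set Om) := <<s \bigcup_(k in [set k | (k <= n)%N]) sigma_of (X k) >>.

(* Markov chain over the steps 0..N, with state space S n at step n. *)
Definition markov_chain (N : nat) (S : nat -> set 'cV[R]_d) (K : chain) : Prop :=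
  [/\ forall n, (n <= N)%N -> sigma_of (ch_Y K n) `<=` measurable,
      forall n w, (n <= N)%N -> S n (ch_Y K n w)
    & forall n B, (n < N)%N -> borel B -> exists Z,
        is_condexp (ch_prob K) (sigma_of (ch_Y K n))
          \1_(ch_Y K n.+1 @^-1` B) Z /\
        is_condexp (ch_prob K) (sigma_upto (ch_Y K) n)
          \1_(ch_Y K n.+1 @^-1` B) Z].

Definition increment (K : chain) (n : nat) (w : ch_space K) : 'cV[R]_d :=
  ch_Y K n.+1 w - ch_Y K n w.

Definition Lp_norm (K : chain) (p : R) m n (X : ch_space K -> 'M[R]_(m, n))
  : \bar R := 'N[ch_prob K]_(p%:E)[(fun w => (enorm (X w))%:E)]%E.

(* In what follows [Yh N] is the chain with N steps; its time step is
   h = T / N, and "for every h" means for every N >= 1. *)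

(* Local moments of order 1, 2, 3. *)
Definition assumption_A1 (T : R) (mu : 'cV[R]_d -> 'cV[R]_d)
    (a : 'cV[R]_d -> 'M[R]_d) (Yh : nat -> chain) : Prop :=
  exists2 hbar : R, 0 < hbar &
  exists (fh : R -> 'cV[R]_d -> 'cV[R]_d) (gh : R -> 'cV[R]_d -> 'M[R]_d)
         (jh : R -> multi_index d -> 'cV[R]_d -> R),
  (forall N n, (0 < N)%N -> (n < N)%N -> T / N%:R < hbar ->
     let h := T / N%:R in
     let Y := ch_Y (Yh N) n in
     let dY := @increment (Yh N) n in
     let is_cond_to_Y := is_condexp (ch_prob (Yh N)) (sigma_of Y) in
     [/\ forall i, is_cond_to_Y (fun w => dY w i 0)
           (fun w => (h *: mu (Y w) + fh h (Y w)) i 0),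
         forall i j, is_cond_to_Y (fun w => (dY w *m (dY w)^T) i j)
           (fun w => (h *: a (Y w) + gh h (Y w)) i j)
       & forall k, mdeg k = 3%N ->
           is_cond_to_Y (fun w => mpow (dY w) k) (fun w => jh h k (Y w))])
  /\
  exists p C : R, [/\ 1 < p, 0 < C &
    forall N n, (0 < N)%N -> (n <= N)%N -> T / N%:R <= hbar ->
      let h := T / N%:R in
      let Y := ch_Y (Yh N) n in
      [/\ (Lp_norm p (fun w => fh h (Y w)) <= (C * h ^+ 2)%:E)%E,
          (Lp_norm p (fun w => gh h (Y w)) <= (C * h ^+ 2)%:E)%E
        & forall k, mdeg k = 3%N ->
            ('N[ch_prob (Yh N)]_(p%:E)[(fun w => (jh h k (Y w))%:E)]
              <= (C * h ^+ 2)%:E)%E]].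

Definition assumption_A2 (T : R) (Yh : nat -> chain) : Prop :=
  exists2 hbar : R, 0 < hbar &
  forall p : R, 1 < p -> exists2 C : R, 0 < C &
    forall N, (0 < N)%N -> T / N%:R < hbar ->
      (forall n, (n <= N)%N -> (Lp_norm p (ch_Y (Yh N) n) <= C%:E)%E) /\
      (forall n, (n < N)%N ->
         (((Num.sqrt (T / N%:R))^-1)%:E * Lp_norm p (@increment (Yh N) n)
            <= C%:E)%E).

End MarkovChain.

Arguments ch_Y {R d} c _ _.

(* Main.v *)
Require Import Defs.
From HB Require Import structures.
From mathcomp Require Import all_boot all_order all_algebra.
Set Warnings "-notation-overridden,-notation-incompatible-prefix".
From mathcomp Require Import all_classical all_reals all_analysis.
From mathcomp Require Import measurable_realfun ring lra.
Set Implicit Arguments.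
Unset Strict Implicit.
Unset Printing Implicit Defensive.
Import Order.TTheory GRing.Theory Num.Theory.
Import numFieldNormedType.Exports.
Local Open Scope classical_set_scope.
Local Open Scope ring_scope.

(** The error telescopes along the chain. Let u be the value function and
    t_n = n h. The mean of f(Y_T) is u(0, y0), because solutions started from
    y0 all have the same law ([same_law_terminal_mean]), and f = u(T, .) on D;
    so the weak error is the sum over n of the means of
    u(t_(n+1), Y_(n+1)) - u(t_n, Y_n). There are T / h such terms, hence it is
    enough to bound each of them by a constant times h^2 ([local_error]).

    For one step with increment z, expand u first in time at the new point and
    then in space at the old one ([taylor_step_bound]). The remainder is at most
    a polynomial weight times |z|^4 + h |z|^2 + h^2; as z is of size sqrt h in
    every L^p, its mean is of order h^2 ([remainder_mean]). The polynomial that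
    is left involves z only through its moments of order one to three, which
    may be replaced by their conditional values given Y_n ([same_mean_step]).
    Up to the three local errors these values are mu h, a h and 0, and the
    backward equation cancels all terms of order h ([moment_step_split]). What
    remains is of order h^2, or is a local error of order h^2 in some L^p, p > 1,
    against a factor of polynomial growth, which Young's inequality handles
    ([bias_mean]).

    Three points need care. The domain may contain boundary points, where the
    derivatives of u are only continuous extensions: expansions are proved for
    interior points and then carried to the boundary along paths that come from
    the interior ([taylor_space], [taylor_time]). At time T there are no
    derivatives at all, and the last step uses that u(t, .) tends to f
    ([taylor_time_terminal]). Finally the coefficients taken out of conditional
    expectations are unbounded: everything is first done on the event that
    |Y_n| <= k, with bounds that do not depend on k ([cutoff]). *)

(** * Mean value estimates and directional derivatives *)

Section Calculus.
Variable R : realType.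

(** Distances to a, rather than an ordered interval, let the same estimate serve
    steps in both directions. *)
Lemma mvt_bound (f df : R -> R) (a b c e : R) :
  (forall x, `|x - a| <= `|b - a| -> is_derive x (1 : R) f (df x)) ->
  (forall x, `|x - a| <= `|b - a| -> `|df x - c| <= e) ->
  `|f b - f a - c * (b - a)| <= e * `|b - a|.
Proof.
move=> fd dfc.
suff [x xab ->] : exists2 x, `|x - a| <= `|b - a| & f b - f a = df x * (b - a).
  by rewrite -mulrBl normrM ler_wpM2r// dfc.
have [ab|ba|->] := ltgtP a b.
- have H x : x \in `[a, b] -> `|x - a| <= `|b - a|.
    by rewrite in_itv/= => /andP[? ?]; rewrite !ger0_norm ?subr_ge0 ?lerB// ltW.
  have [|||x xab ->] := @MVT _ f df a b => //.
  + by move=> x /subset_itv_oo_cc /H /fd.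
  + by apply: derivable_within_continuous => x /H /fd [].
  + by exists x => //; exact/H/subset_itv_oo_cc.
- have H x : x \in `[b, a] -> `|x - a| <= `|b - a|.
    rewrite in_itv/= => /andP[? ?].
    by rewrite !ler0_norm ?subr_le0 ?lerN2 ?lerB// ltW.
  have [|||x xab e1] := @MVT _ f df b a => //.
  + by move=> x /subset_itv_oo_cc /H /fd.
  + by apply: derivable_within_continuous => x /H /fd [].
  + exists x; first exact/H/subset_itv_oo_cc.
    by rewrite -opprB e1; ring.
- by exists b; [rewrite !subrr|rewrite !subrr mulr0].
Qed.

(** Taylor's formula with a crude remainder: bounding the remainder by a
    constant times s^n instead of s^n / n! lets the mean value theorem carry
    the induction without integration. *)
Lemma taylor_bound (n : nat) (phi : nat -> R -> R) (M s : R) :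
  0 <= s ->
  (forall j (x : R), (j < n)%N -> 0 <= x <= s -> is_derive x (1 : R) (phi j) (phi j.+1 x)) ->
  (forall x : R, 0 <= x <= s -> `|phi n x| <= M) ->
  `|phi 0%N s - \sum_(j < n) phi j 0 * (s ^+ j / j`!%:R)| <= M * s ^+ n.
Proof.
elim: n phi s => [|n IH] phi s s0 dphi bM.
  by rewrite big_ord0 subr0 expr0 mulr1 bM// s0 lexx.
pose psi x := phi 0%N x - \sum_(j < n.+1) phi j 0 * (x ^+ j / j`!%:R).
pose dpsi x := phi 1%N x - \sum_(j < n) phi j.+1 0 * (x ^+ j / j`!%:R).
have psi0 : psi 0 = 0.
  rewrite /psi big_ord_recl/= expr0 fact0 divr1 mulr1 big1 ?addr0 ?subrr//.
  by move=> i _; rewrite exprS mul0r mul0r mulr0.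
have dpsiE x : 0 <= x <= s -> is_derive x (1 : R) psi (dpsi x).
  move=> xs; rewrite /psi /dpsi.
  apply: (@is_deriveB _ _ _ (phi 0%N)); first exact: dphi.
  have -> : (fun x => \sum_(j < n.+1) phi j 0 * (x ^+ j / j`!%:R)) =
    \sum_(j < n.+1) ((phi j 0 / j`!%:R) *: (@GRing.exp R ^~ (j : nat))).
    apply/funext => y; rewrite fct_sumE; apply: eq_bigr => j _.
    by transitivity (phi j 0 / j`!%:R * y ^+ j); [ring|].
  have -> : \sum_(j < n) phi j.+1 0 * (x ^+ j / j`!%:R) =
    \sum_(j < n.+1) ((phi j 0 / j`!%:R) *: (j%:R * x ^+ j.-1)).
    rewrite big_ord_recl/= mul0r scaler0 add0r; apply: eq_bigr => j _.
    rewrite /GRing.scale/= /bump/= add1n add0n factS natrM.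
    have ? : (j`!%:R : R) != 0 by rewrite pnatr_eq0 -lt0n fact_gt0.
    have ? : (j.+1%:R : R) != 0 by rewrite pnatr_eq0.
    by field; apply/andP; split.
  apply: is_derive_sum => j; apply: is_deriveZ.
  split; first exact: exprn_derivable.
  by rewrite exp_derive /GRing.scale/= mulr1.
have bdpsi x : 0 <= x <= s -> `|dpsi x| <= M * x ^+ n.
  move=> /andP[x0 xs]; apply: (IH (fun j => phi j.+1)) => //.
  - by move=> j y jn /andP[y0 yx]; apply: dphi => //; rewrite y0 (le_trans yx).
  - by move=> y /andP[y0 yx]; apply: bM; rewrite y0 (le_trans yx).
have M0 : 0 <= M.
  by apply: le_trans (bM 0 _); rewrite // lexx.
rewrite -/(psi s) -[psi s]subr0 -psi0 exprSr mulrA.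
have {3}-> : s = `|s - 0| by rewrite subr0 ger0_norm.
rewrite -[X in `|X|]subr0 -[X in _ - X](mul0r (s - 0)).
have [->|sn0] := eqVneq s 0; first by rewrite !subrr mul0r subrr normr0 mulr0.
have [|||x xab ->] := @MVT R psi dpsi 0 s.
- by rewrite lt_neqAle eq_sym sn0.
- by move=> x; rewrite in_itv/= => /andP[? ?]; apply: dpsiE; rewrite !ltW.
- apply: derivable_within_continuous => x; rewrite in_itv/= => xs.
  by have [] := dpsiE _ xs.
rewrite mul0r subr0 normrM ler_wpM2r//.
move: xab; rewrite in_itv/= => /andP[x0 xs].
rewrite (le_trans (bdpsi x _))//; first by rewrite !ltW.
by rewrite ler_wpM2l// lerXn2r// ?nnegrE ltW.
Qed.

Variable d : nat.
Implicit Types (y z : 'cV[R]_d) (O : set 'cV[R]_d).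

Lemma norm_delta_le (i : 'I_d) : `|delta_mx i 0 : 'cV[R]_d| <= 1.
Proof.
rewrite [leLHS]mx_normrE; apply: bigmax_le => // -[j k] _ /=.
by rewrite mxE; case: (_ && _); rewrite ?normr1 ?normr0.
Qed.

Lemma norm_coord_le m n (A : 'M[R]_(m, n)) i j : `|A i j| <= `|A|.
Proof.
rewrite [leRHS]mx_normrE.
by apply: (@le_bigmax _ _ _ _ (fun ij => `|A ij.1 ij.2|) (i, j)).
Qed.

(** Move one coordinate at a time: each of the d partial increments is controlled
    by the mean value theorem and the continuity at y of one partial derivative.
    All intermediate points stay in a ball around y inside O. *)
Lemma directional_derive O (g : 'cV[R]_d -> R) (dg : 'I_d -> 'cV[R]_d -> R) y z :
  open O -> O y ->
  (forall i x, O x -> is_derive x (delta_mx i 0 : 'cV[R]_d) g (dg i x)) ->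
  (forall i, {for y, continuous (dg i)}) ->
  is_derive y z g (\sum_i z i 0 * dg i y).
Proof.
move=> oO Oy dgE cdg.
pose L := \sum_i z i 0 * dg i y.
suff H : h^-1 *: ((g \o shift y) (h *: z) - g y) @[h --> 0^'] --> L.
  by split; [apply/cvg_ex; exists L | exact: cvg_lim H].
apply/cvgrPdist_le => e e0.
pose S := 1 + \sum_i `|z i 0|.
have S0 : 0 < S by rewrite /S ltr_pwDl// sumr_ge0.
have : \forall x \near y, O x /\ forall i, `|dg i x - dg i y| <= e / S.
  apply: filterI; first exact: open_nbhs_nbhs.
  have F : Filter (nbhs y) by typeclasses eauto.
  refine (@filter_forall _ 'I_d (fun i x => `|dg i x - dg i y| <= e / S) _ F _) => i.
  have := cdg i; move/cvgrPdist_le => /(_ (e / S) (divr_gt0 e0 S0)).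
  by apply: filterS => x; rewrite distrC.
move=> /nbhs_ballP[r /= r0 rO].
near=> h.
have h0 : h != 0 by near: h; exact: nbhs_dnbhs_neq.
have hr : `|h| * S < r.
  rewrite -ltr_pdivlMr//; near: h; apply: dnbhs0_lt; exact: divr_gt0.
(* the telescoping over coordinates, as an induction on a list of them *)
have key (s : seq 'I_d) : `|h| * \sum_(i <- s) `|z i 0| < r ->
    `|g (h *: \sum_(i <- s) z i 0 *: delta_mx i 0 + y) - g y
       - h * \sum_(i <- s) z i 0 * dg i y|
    <= e / S * (`|h| * \sum_(i <- s) `|z i 0|).
  elim: s => [|i s IH]; first by rewrite !big_nil scaler0 add0r subrr !mulr0 subrr normr0.
  rewrite !big_cons => hs.
  set w := \sum_(j <- s) z j 0 *: delta_mx j 0.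
  have hs' : `|h| * \sum_(j <- s) `|z j 0| < r.
    by apply: le_lt_trans hs; rewrite ler_wpM2l// lerDr.
  have wle : `|w| <= \sum_(j <- s) `|z j 0|.
    apply: le_trans (ler_norm_sum _ _ _) _; apply: ler_sum => j _.
    by rewrite normrZ ler_piMr// norm_delta_le.
  have inO x : `|x - 0| <= `|h * z i 0| -> ball y r (x *: delta_mx i 0 + (h *: w + y)).
    rewrite subr0 => xle; rewrite -ball_normE /= distrC addrA addrK.
    apply: le_lt_trans hs; rewrite mulrDr (le_trans (ler_normD _ _))// lerD//.
      by rewrite normrZ -normrM (le_trans _ xle)// ler_piMr// norm_delta_le.
    by rewrite normrZ ler_wpM2l.
  have H : `|g ((h * z i 0) *: delta_mx i 0 + (h *: w + y)) - g (h *: w + y)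
      - dg i y * (h * z i 0)| <= e / S * `|h * z i 0|.
   have := @mvt_bound (fun x => g (x *: delta_mx i 0 + (h *: w + y)))
    (fun x => dg i (x *: delta_mx i 0 + (h *: w + y))) 0 (h * z i 0)
    (dg i y) (e / S).
   rewrite !subr0 scale0r add0r; apply.
  - move=> x xle; have [Ox _] := rO _ (inO x xle).
    have [gd gv] := dgE i _ Ox.

    have E : (fun k : R => k^-1 *: (((fun x0 : R => g (x0 *: delta_mx i 0 + (h *: w + y)))
        \o shift x) (k *: (1 : R)) - g (x *: delta_mx i 0 + (h *: w + y)))) =
      (fun k : R => k^-1 *: ((g \o shift (x *: delta_mx i 0 + (h *: w + y)))
         (k *: delta_mx i 0) - g (x *: delta_mx i 0 + (h *: w + y)))).
      apply/funext => k /=; congr (_ *: (g _ - _)).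
      have -> : k *: (1 : R) = k by exact: mulr1.
      by rewrite scalerDl; exact/esym/addrA.
    by split; rewrite /derivable /derive E.
  - by move=> x xle; have [_] := rO _ (inO x xle).
  have -> : h *: (z i 0 *: delta_mx i 0 + w) + y =
            (h * z i 0) *: delta_mx i 0 + (h *: w + y).
    by rewrite scalerDr scalerA addrA.
  have tel (A B C D E : R) : A - B - h * (C + D) =
            (A - E - C * h) + (E - B - h * D) by ring.
  rewrite (tel _ _ _ _ (g (h *: w + y))) mulrDr mulrDr -normrM.
  rewrite (le_trans (ler_normD _ _))// lerD//; last exact: IH.
  by have -> : z i 0 * dg i y * h = dg i y * (h * z i 0) by ring.
have := key (index_enum 'I_d).
have -> : \sum_i z i 0 *: delta_mx i 0 = z.
  rewrite [RHS]matrix_sum_delta; apply: eq_bigr => i _.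
  by rewrite big_ord1.
have hS : `|h| * (\sum_i `|z i 0|) <= `|h| * S by rewrite ler_wpM2l// /S lerDr.
move=> /(_ (le_lt_trans hS hr)) H.
have -> : L - h^-1 *: ((g \o shift y) (h *: z) - g y) =
    - (h^-1 * (g (h *: z + y) - g y - h * L)).
  by rewrite [in RHS]mulrBr mulKf// opprB.
rewrite normrN normrM normfV ler_pdivrMl ?normr_gt0// (le_trans H)//.
have eS0 : 0 <= e / S by rewrite divr_ge0// ltW.
rewrite (le_trans (ler_wpM2l eS0 hS))// mulrCA divfK// lt0r_neq0//.
Unshelve. all: by end_near. Qed.
End Calculus.

(** * Segments in the domain and the Taylor expansion inside it *)

Section ConvexPaths.
Variables (R : realType) (d : nat).
Implicit Types (y z o : 'cV[R]_d) (O D : set 'cV[R]_d).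

Definition segment_closed O :=
  forall y z (s : R), O y -> O z -> 0 <= s <= 1 -> O ((1 - s) *: y + s *: z).

Lemma convex_set_segment O :
  convex_set (O : set (convex_lmodType 'cV[R]_d)) -> segment_closed O.
Proof.
move=> cO y z s Oy Oz /andP[s0 s1].
have := @cO z y (Itv01 s0 s1) (mem_set Oz) (mem_set Oy).
rewrite inE /conv/= => H.
by rewrite addrC; exact: H.
Qed.

(** A point of the segment from y to o is also a convex combination of a point
    y' of O close to y and of a small perturbation o' of o, which is in O since
    O is open. *)
Lemma segment_closure_open O y o (e : R) : open O -> segment_closed O ->
  closure O y -> O o -> 0 < e <= 1 -> O ((1 - e) *: y + e *: o).
Proof.
move=> oO cO clOy Oo /andP[e0 e1].
have /nbhs_ballP[r /= r0 rO] : nbhs o O by exact: open_nbhs_nbhs.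
have [y' [Oy' yy']] := clOy _ (nbhsx_ballx y (e * r) (mulr_gt0 e0 r0)).
have en0 : e != 0 by rewrite lt0r_neq0.
pose o' := o + ((1 - e) / e) *: (y - y').
have Oo' : O o'.
  apply: rO; rewrite -ball_normE/= /o' opprD addrA subrr sub0r normrN normrZ.
  have ie : 0 <= (1 - e) / e by rewrite divr_ge0 ?subr_ge0// ltW.
  move: yy'; rewrite -ball_normE/= => yy'.
  rewrite ger0_norm// mulrAC ltr_pdivrMr// [ltRHS]mulrC.
  apply: le_lt_trans yy'; rewrite ler_piMl// ?normr_ge0//.
  by rewrite gerBl ltW.
suff -> : (1 - e) *: y + e *: o = (1 - e) *: y' + e *: o'.
  by apply: cO => //; rewrite ltW.
rewrite /o' [e *: (o + _)]scalerDr scalerA mulrCA divff// mulr1 scalerBr.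
by rewrite [RHS]addrCA [X in _ = _ + X]addrC subrK addrC.
Qed.

Lemma within_continuous_cvg (U V : topologicalType) (T : Type)
  (F : set_system T) (FF : Filter F) (A : set U) (f : U -> V) (p : T -> U) u :
  {within A, continuous f} -> A u -> p x @[x --> F] --> u ->
  (\forall x \near F, A (p x)) -> f (p x) @[x --> F] --> f u.
Proof.
move=> /subspace_continuousP cf Au pu pA.
apply: (@cvg_comp _ _ _ p f F (within A (nbhs u))); last exact: cf.
move=> B /pu; rewrite /nbhs/= => BA.
by near=> x; have : A (p x) -> B (p x); [near: x|apply; near: x].
Unshelve. all: by end_near. Qed.

End ConvexPaths.

Section IteratedDerivatives.
Variables (R : realType) (d : nat).
Variable dv : nat -> multi_index d -> R -> 'cV[R]_d -> R.
Implicit Types (y z : 'cV[R]_d) (k n : nat) (l : multi_index d).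

(** The n-th derivative in the direction z of the derivative of index (k, l),
    written as nested sums so that the recursion follows the chain rule. *)
Fixpoint dird k n l z t y : R :=
  if n is n'.+1 then \sum_i z i 0 * dird k n' (mincr l i) z t y else dv k l t y.

Lemma mdeg_mincr l i : mdeg (mincr l i) = (mdeg l).+1.
Proof.
rewrite /mdeg; under eq_bigr do rewrite ffunE.
rewrite big_split/= -[RHS]addn1; congr (_ + _)%N.
by rewrite (bigD1 i)//= eqxx big1// => j /negPf ->.
Qed.

Lemma mdeg_mindex0 : mdeg (mindex0 d) = 0%N.
Proof. by rewrite /mdeg big1// => i _; rewrite ffunE. Qed.

Lemma norm_dird_le k n l z t y (B : R) : 0 <= B ->
  (forall l', mdeg l' = (mdeg l + n)%N -> `|dv k l' t y| <= B) ->
  `|dird k n l z t y| <= (d%:R * `|z|) ^+ n * B.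
Proof.
move=> B0; elim: n l => [|n IH] l bB /=.
  by rewrite expr0 mul1r bB// addn0.
apply: le_trans (ler_norm_sum _ _ _) _.
have -> : (d%:R * `|z|) ^+ n.+1 * B =
  \sum_(i < d) `|z| * ((d%:R * `|z|) ^+ n * B).
  by rewrite sumr_const card_ord -[RHS]mulr_natl exprS -!mulrA.
apply: ler_sum => i _; rewrite normrM ler_pM//; first exact: norm_coord_le.
by apply: IH => l' l'E; apply: bB; rewrite l'E mdeg_mincr addnS.
Qed.

Lemma cvg_dird (T : Type) (F : set_system T) (FF : Filter F) k n l
    (z_ : T -> 'cV[R]_d) (t_ : T -> R) (y_ : T -> 'cV[R]_d) z t y :
  z_ x @[x --> F] --> z ->
  (forall l', mdeg l' = (mdeg l + n)%N ->
    dv k l' (t_ x) (y_ x) @[x --> F] --> dv k l' t y) ->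
  dird k n l (z_ x) (t_ x) (y_ x) @[x --> F] --> dird k n l z t y.
Proof.
move=> zz; elim: n l => [|n IH] l cdv /=; first by apply: cdv; rewrite addn0.
apply: cvg_big; first exact: add_continuous.
move=> i _; apply: cvgM.
  exact: (@cvg_comp _ _ _ _ (fun A : 'cV[R]_d => A i 0) _ _ _ zz (@coord_continuous _ _ _ i 0 z)).
by apply: IH => l' l'E; apply: cdv; rewrite l'E mdeg_mincr addnS.
Qed.

Lemma is_derive_line (g : 'cV[R]_d -> R) a z (s L : R) :
  is_derive (a + s *: z) z g L ->
  is_derive s (1 : R) (fun r => g (a + r *: z)) L.
Proof.
move=> [gd gv].
have E : (fun k : R => k^-1 *: (((fun r : R => g (a + r *: z))
    \o shift s) (k *: (1 : R)) - g (a + s *: z))) =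
  (fun k : R => k^-1 *: ((g \o shift (a + s *: z)) (k *: z) - g (a + s *: z))).
  apply/funext => k /=; congr (_ *: (g _ - _)).
  have -> : k *: (1 : R) = k by exact: mulr1.
  by rewrite scalerDl addrCA.
by split; rewrite /derivable /derive E.
Qed.

Variables (T : R) (D O : set 'cV[R]_d) (q : nat) (v : R -> 'cV[R]_d -> R).
Hypothesis dvP : pderivs T D q v dv.
Hypothesis oO : open O.
Hypothesis OD : O `<=` D.
Hypothesis cO : segment_closed O.
Hypothesis DO : D `<=` closure O.

Lemma O_interior : O `<=` D°.
Proof. by rewrite -open_subsetE. Qed.

Lemma dv_continuous_space k l (t : R) y : (2 * k + mdeg l <= q)%N -> 0 < t < T ->
  O y -> {for y, continuous (dv k l t)}.
Proof.
move=> kl /andP[t0 tT] Oy; have [_ cdv _ _] := dvP.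
have := @within_continuous_cvg _ _ _ (nbhs y) _ _ (fun p => dv k l p.1 p.2)
  (fun x => (t, x)) (t, y) (cdv _ _ kl); apply => /=.
- by rewrite ltW//= tT; split => //; exact: OD.
- exact: (cvg_pair (cvg_cst t) cvg_id).
- near=> x; rewrite ltW//= tT; split=> //; apply: OD.
  by near: x; exact: open_nbhs_nbhs.
Unshelve. all: by end_near. Qed.

Lemma is_derive_dird k n l z (t : R) y : (2 * k + mdeg l + n.+1 <= q)%N ->
  0 < t < T -> O y ->
  is_derive y z (dird k n l z t) (dird k n.+1 l z t y).
Proof.
move=> + t0T; elim: n l y => [|n IH] l y klq Oy.
  have [_ _ _ ddv] := dvP.
  apply: (@directional_derive R d O (dird k 0 l z t)
      (fun i => dird k 0 (mincr l i) z t)) => //=.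
  - by move=> i x Ox; apply: ddv => //; [rewrite addnS -addn1|exact: O_interior].
  - by move=> i; apply: dv_continuous_space => //; rewrite mdeg_mincr addnS -addn1.
have -> : dird k n.+1 l z t = \sum_i (z i 0 *: dird k n (mincr l i) z t).
  by apply/funext => x /=; rewrite fct_sumE.
apply: is_derive_sum => i; apply: is_deriveZ; apply: IH => //.
by move: klq; rewrite mdeg_mincr !addnS addSn.
Qed.

(** Polynomial growth measured by weights with natural exponents: they are at
    least 1 and closed under products and powers. *)
Definition weight m y : R := (1 + `|y|) ^+ m.

Lemma weight_ge0 m y : 0 <= weight m y.
Proof. by rewrite exprn_ge0// addr_ge0. Qed.

Lemma weight_ge1 m y : 1 <= weight m y.
Proof. by rewrite exprn_ege1// lerDl. Qed.

(** The convex combination of 1 + |y| and 1 + |y'| is at most their product, as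
    both are at least 1. *)
Lemma weight_segment m y y' (s : R) : 0 <= s <= 1 ->
  weight m (y + s *: (y' - y)) <= weight m y * weight m y'.
Proof.
move=> /andP[s0 s1]; rewrite /weight -exprMn lerXn2r ?nnegrE ?addr_ge0 ?mulr_ge0 ?addr_ge0//.
have -> : y + s *: (y' - y) = (1 - s) *: y + s *: y'.
  by rewrite scalerBr scalerBl scale1r -addrA [s *: y' - _]addrC.
have h1 := ler_normD ((1 - s) *: y) (s *: y').
rewrite !normrZ (ger0_norm s0) (@ger0_norm _ (1 - s)) ?subr_ge0// in h1.
have y0 := normr_ge0 y; have y'0 := normr_ge0 y'.
have : (1 - s) * `|y| <= `|y| by rewrite ler_piMl// gerBl.
have : s * `|y'| <= `|y'| by rewrite ler_piMl.
have := mulr_ge0 y0 y'0; lra.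
Qed.

Variables (C : R) (m : nat).
Hypothesis bdv : forall k l, (2 * k + mdeg l <= q)%N -> forall (t : R) y,
  0 <= t < T -> D y -> `|dv k l t y| <= C * weight m y.

Let C0 : D !=set0 -> 0 < T -> 0 <= C.
Proof.
move=> [y Dy] T0.
have := @bdv 0 (mindex0 d) _ 0 y _ Dy; rewrite mdeg_mindex0 lexx T0 => /(_ _ _).
move=> /(_ isT isT) H.
have : 0 <= C * weight m y := le_trans (normr_ge0 _) H.
by rewrite pmulr_lge0// (lt_le_trans _ (weight_ge1 m y)).
Qed.

Lemma taylor_space_interior k n (t : R) y y' : (2 * k + n <= q)%N ->
  0 < t < T -> O y -> O y' ->
  `|dv k (mindex0 d) t y'
     - \sum_(j < n) dird k j (mindex0 d) (y' - y) t y / j`!%:R|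
  <= (d%:R * `|y' - y|) ^+ n * (C * (weight m y * weight m y')).
Proof.
move=> knq t0T Oy Oy'.
have /andP[t0 tT] := t0T.
have Cge0 : 0 <= C by apply: C0; [exists y; exact: OD|exact: lt_trans tT].
have inO s : 0 <= s <= 1 -> O (y + s *: (y' - y)).
  move=> s01; have := cO Oy Oy' s01.
  by rewrite scalerBr scalerBl scale1r -addrA [- _ + _]addrC.
have := @taylor_bound R n
  (fun j s => dird k j (mindex0 d) (y' - y) t (y + s *: (y' - y)))
  ((d%:R * `|y' - y|) ^+ n * (C * (weight m y * weight m y'))) 1 ler01.
rewrite expr1n mulr1 scale1r [y + (y' - y)]addrC subrK scale0r addr0 /=.
under eq_bigr do rewrite expr1n mul1r.
apply.
- move=> j x jn x01; apply: is_derive_line; apply: is_derive_dird => //; last exact: inO.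
  by rewrite mdeg_mindex0 addn0 (leq_trans _ knq)// leq_add2l.
- move=> x x01; apply: norm_dird_le.
    by rewrite !mulr_ge0// weight_ge0.
  rewrite mdeg_mindex0 add0n => l' l'n.
  apply: le_trans (bdv _ _ _) _; rewrite ?l'n//; first by rewrite ltW.
    exact/OD/inO.
  by rewrite ler_wpM2l// weight_segment.
Qed.

Lemma taylor_time_interior (t s : R) y : (4 <= q)%N ->
  0 < t -> t < s -> s < T -> O y ->
  `|dv 0 (mindex0 d) s y - dv 0 (mindex0 d) t y - (s - t) * dv 1 (mindex0 d) t y|
  <= C * weight m y * (s - t) ^+ 2.
Proof.
move=> q4 t0 ts sT Oy.
have h0 : 0 <= s - t by rewrite subr_ge0 ltW.
have [_ _ tdv _] := dvP.
have := @taylor_bound R 2 (fun j r => dv j (mindex0 d) (t + r) y)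
  (C * weight m y) (s - t) h0.
rewrite !big_ord_recl big_ord0 /= addr0 [t + (s - t)]addrC subrK !addr0 expr0.
rewrite expr1 fact0 /bump/= add1n !divr1 mulr1 opprD addrA [_ * (s - t)]mulrC.
apply.
- move=> j x j2 /andP[x0 xs].
  have xI : 0 < t + x < T.
    by rewrite ltr_wpDr//=; apply: le_lt_trans sT; rewrite -lerBrDl.
  have := tdv j (mindex0 d) (t + x) y _ xI (O_interior Oy).
  rewrite mdeg_mindex0 addn0 => /(_ (leq_trans _ q4)) /=.
  have -> : (2 * j.+1 <= 4)%N by case: j j2 => [|[|]].
  move=> /(_ isT) H.
  rewrite -[dv j.+1 _ _ _]mulr1.
  have -> : (fun r => dv j (mindex0 d) (t + r) y) =
    (fun s => dv j (mindex0 d) s y) \o shift t.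
    by apply/funext => r /=; rewrite addrC.
  apply: is_derive1_comp; last exact: is_derive_shift.
  by rewrite /= addrC.
- move=> x /andP[x0 xs]; apply: bdv; last exact: OD.
    by rewrite mdeg_mindex0.
  by rewrite addr_ge0 ?(ltW t0)//=; apply: le_lt_trans sT; rewrite -lerBrDl.
Qed.

End IteratedDerivatives.

(** * The expansion up to the boundary and the terminal time *)

Section BoundaryExtension.
Variables (R : realType) (d : nat) (T : R) (D O : set 'cV[R]_d) (o : 'cV[R]_d).
Hypothesis T0 : 0 < T.
Hypothesis oO : open O.
Hypothesis OD : O `<=` D.
Hypothesis cO : segment_closed O.
Hypothesis DO : D `<=` closure O.
Hypothesis Oo : O o.
Implicit Types (y z : 'cV[R]_d) (k n : nat) (l : multi_index d) (t e : R).

(** For e in ]0, 1] the path e |-> (inward_time t e, inward y e) runs in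
    ]0, T[ x O, where the derivatives exist, and it tends to (t, y) as e -> 0;
    along it inequalities between continuous functions reach all of [0, T[ x D. *)
Definition inward_time t e : R := (1 - e) * t + e * (T / 2).
Definition inward y e : 'cV[R]_d := (1 - e) *: y + e *: o.

Lemma cvg_inward_time t : inward_time t e @[e --> 0^'+] --> t.
Proof.
apply: cvg_at_right_filter; have {2}-> : t = inward_time t 0.
  by rewrite /inward_time subr0 mul1r mul0r addr0.
apply: cvgD; apply: cvgM; try exact: cvg_cst; last exact: cvg_id.
by apply: cvgB; [exact: cvg_cst|exact: cvg_id].
Qed.

Lemma cvg_inward y : inward y e @[e --> 0^'+] --> y.
Proof.
apply: cvg_at_right_filter; have {2}-> : y = inward y 0.
  by rewrite /inward subr0 scale1r scale0r addr0.
apply: cvgD; apply: cvgZ; try exact: cvg_cst; last exact: cvg_id.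
by apply: cvgB; [exact: cvg_cst|exact: cvg_id].
Qed.

Lemma inward_open y e : D y -> 0 < e <= 1 -> O (inward y e).
Proof. by move=> /DO Dy e01; exact: segment_closure_open. Qed.

Lemma inward_time_lt t e : 0 <= t < T -> 0 < e <= 1 -> 0 < inward_time t e < T.
Proof.
move=> /andP[t0 tT] /andP[e0 e1]; rewrite /inward_time.
have h : 0 < e * (T / 2) by rewrite mulr_gt0// divr_gt0.
have k : 0 <= (1 - e) * t by rewrite mulr_ge0// subr_ge0.
apply/andP; split; first exact: ltr_wpDl.
have : (1 - e) * t <= (1 - e) * T by rewrite ler_wpM2l ?subr_ge0// ltW.
lra.
Qed.

Lemma near_inward : \forall e \near (0 : R)^'+, 0 < e <= 1.
Proof.
near=> e; apply/andP; split; first by near: e; exact: nbhs_right_gt.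
by near: e; exact: nbhs_right_le.
Unshelve. all: by end_near. Qed.

Section OneFamily.
Variables (q : nat) (v : R -> 'cV[R]_d -> R).
Variable dv : nat -> multi_index d -> R -> 'cV[R]_d -> R.
Hypothesis dvP : pderivs T D q v dv.

Lemma cvg_dv_inward k l t y : (2 * k + mdeg l <= q)%N -> 0 <= t < T -> D y ->
  dv k l (inward_time t e) (inward y e) @[e --> 0^'+] --> dv k l t y.
Proof.
move=> kl t0T Dy; have [_ cdv _ _] := dvP.
have := @within_continuous_cvg _ _ _ (0 : R)^'+ _ _ (fun p => dv k l p.1 p.2)
  (fun e => (inward_time t e, inward y e)) (t, y) (cdv _ _ kl); apply => //=.
- exact: (cvg_pair (@cvg_inward_time t) (@cvg_inward y)).
- apply: filterS near_inward => e e01.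
  have /andP[/ltW-> ->] := inward_time_lt t0T e01; split=> //.
  exact/OD/inward_open.
Qed.

Variables (C : R) (m : nat).
Hypothesis bdv : forall k l, (2 * k + mdeg l <= q)%N -> forall (t : R) y,
  0 <= t < T -> D y -> `|dv k l t y| <= C * weight m y.

Lemma cvg_exprn (X : Type) (F : set_system X) (FF : Filter F)
  (f : X -> R) (a : R) p : f x @[x --> F] --> a -> f x ^+ p @[x --> F] --> a ^+ p.
Proof.
move=> fa.
exact: (@continuous_cvg _ _ _ F FF f (fun x => x ^+ p) a (@exprn_continuous _ p a) fa).
Qed.

Lemma cvg_weight (X : Type) (F : set_system X) (FF : Filter F)
  (y_ : X -> 'cV[R]_d) y : y_ x @[x --> F] --> y ->
  weight m (y_ x) @[x --> F] --> weight m y.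
Proof.
move=> yy; rewrite /weight.
have H : (1 + `|y_ x|) @[x --> F] --> 1 + `|y|.
  by apply: cvgD; [exact: cvg_cst|exact: cvg_norm].
exact: cvg_exprn H.
Qed.

Lemma taylor_space k n t y y' : (2 * k + n <= q)%N ->
  0 <= t < T -> D y -> D y' ->
  `|dv k (mindex0 d) t y'
     - \sum_(j < n) dird dv k j (mindex0 d) (y' - y) t y / j`!%:R|
  <= (d%:R * `|y' - y|) ^+ n * (C * (weight m y * weight m y')).
Proof.
move=> knq t0T Dy Dy'.
have cz : inward y' e - inward y e @[e --> 0^'+] --> y' - y.
  by apply: cvgB; exact: cvg_inward.
apply: (@ler_cvg_to _ (0 : R)^'+ _ _
  (fun e => `|dv k (mindex0 d) (inward_time t e) (inward y' e)
     - \sum_(j < n) dird dv k j (mindex0 d) (inward y' e - inward y e)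
          (inward_time t e) (inward y e) / j`!%:R|)
  (fun e => (d%:R * `|inward y' e - inward y e|) ^+ n
     * (C * (weight m (inward y e) * weight m (inward y' e))))).
- apply: cvg_norm; apply: cvgB.
    apply: cvg_dv_inward => //; rewrite mdeg_mindex0 addn0.
    by rewrite (leq_trans _ knq)// leq_addr.
  apply: cvg_big; first exact: add_continuous.
  move=> j _; apply: cvgM; last exact: cvg_cst.
  apply: cvg_dird => // l' l'j; apply: cvg_dv_inward => //.
  rewrite l'j mdeg_mindex0 add0n (leq_trans _ knq)// leq_add2l.
  exact: ltnW.
- apply: cvgM.
    have H : (d%:R * `|inward y' e - inward y e|) @[e --> 0^'+] -->
      d%:R * `|y' - y|.
      by apply: cvgM; [exact: cvg_cst|exact: cvg_norm].
    exact: cvg_exprn H.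
  apply: cvgM; first exact: cvg_cst.
  by apply: cvgM; apply: cvg_weight; exact: cvg_inward.
- apply: filterS near_inward => e e01.
  apply: (taylor_space_interior dvP oO OD cO bdv) => //.
  + exact: inward_time_lt.
  + exact: inward_open.
  + exact: inward_open.
Qed.

Lemma taylor_time t s y : (4 <= q)%N -> 0 <= t -> t < s -> s < T -> D y ->
  `|dv 0 (mindex0 d) s y - dv 0 (mindex0 d) t y - (s - t) * dv 1 (mindex0 d) t y|
  <= C * weight m y * (s - t) ^+ 2.
Proof.
move=> q4 t0 ts sT Dy.
have tI : 0 <= t < T by rewrite t0 (lt_trans ts).
have sI : 0 <= s < T by rewrite sT (le_trans t0)// ltW.
have le1q k : (k <= 1)%N -> (2 * k + mdeg (mindex0 d) <= q)%N.
  by move=> k1; rewrite mdeg_mindex0 addn0 (leq_trans _ q4)//; case: k k1 => [|[|k]].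
have cst : inward_time s e - inward_time t e @[e --> 0^'+] --> s - t.
  by apply: cvgB; exact: cvg_inward_time.
apply: (@ler_cvg_to _ (0 : R)^'+ _ _
  (fun e => `|dv 0 (mindex0 d) (inward_time s e) (inward y e)
     - dv 0 (mindex0 d) (inward_time t e) (inward y e)
     - (inward_time s e - inward_time t e) *
       dv 1 (mindex0 d) (inward_time t e) (inward y e)|)
  (fun e => C * weight m (inward y e) * (inward_time s e - inward_time t e) ^+ 2)).
- apply: cvg_norm; apply: cvgB; first apply: cvgB.
  + by apply: cvg_dv_inward => //; exact: le1q.
  + by apply: cvg_dv_inward => //; exact: le1q.
  + by apply: cvgM => //; apply: cvg_dv_inward => //; exact: le1q.
- apply: cvgM.
    by apply: cvgM; [exact: cvg_cst|apply: cvg_weight; exact: cvg_inward].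
  exact: cvg_exprn cst.
- near=> e.
  have e01 : 0 < e <= 1 by near: e; exact: near_inward.
  have e1 : e < 1 by near: e; exact: nbhs_right_lt.
  have /andP[ti0 _] := inward_time_lt tI e01.
  have /andP[_ siT] := inward_time_lt sI e01.
  have tsi : inward_time t e < inward_time s e.
    by rewrite /inward_time ltrD2r ltr_pM2l// subr_gt0.
  have H := taylor_time_interior dvP oO OD bdv q4 ti0 tsi siT.
  by apply: H; exact: inward_open.
Unshelve. all: by end_near. Qed.

(** The terminal time, where no derivative is available, is reached by letting
    the endpoint of the time step increase to it. *)
Lemma taylor_time_terminal t s y : (4 <= q)%N -> 0 <= t -> t < s -> s <= T ->
  D y -> v t y @[t --> T^'-] --> v T y ->
  `|v s y - v t y - (s - t) * dv 1 (mindex0 d) t y|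
  <= C * weight m y * (s - t) ^+ 2.
Proof.
move=> q4 t0 ts sT Dy cvT; have [dv0 _ _ _] := dvP.
have tT : t < T := lt_le_trans ts sT.
have main r : t < r -> r < T -> `|v r y - v t y - (r - t) * dv 1 (mindex0 d) t y|
    <= C * weight m y * (r - t) ^+ 2.
  move=> tr rT; rewrite -!dv0 ?t0//; first exact: taylor_time.
  by rewrite rT (le_trans t0)// ltW.
move: sT; rewrite le_eqVlt => /predU1P[sT|sT]; last exact: main.
rewrite {s}sT in ts *.
have cid : (r - t) @[r --> T^'-] --> T - t.
  apply: cvgB; last exact: cvg_cst.
  by apply: cvg_at_left_filter; exact: cvg_id.
apply: (@ler_cvg_to _ T^'- _ _
  (fun r => `|v r y - v t y - (r - t) * dv 1 (mindex0 d) t y|)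
  (fun r => C * weight m y * (r - t) ^+ 2)).
- apply: cvg_norm; apply: cvgB; first by apply: cvgB => //; exact: cvg_cst.
  by apply: cvgM => //; exact: cvg_cst.
- apply: cvgM; first exact: cvg_cst.
  exact: cvg_exprn cid.
- near=> r; apply: main; first by near: r; exact: nbhs_left_gt.
  by near: r; exact: nbhs_left_lt.
Unshelve. all: by end_near. Qed.

(** When z is of size sqrt h the terms left out are of order h^2. The cubic term
    and the mixed one are of order h^(3/2): they are kept because only their
    means are smaller. *)
Definition taylor_step t h z y : R :=
  dird dv 0 1 (mindex0 d) z t y + dird dv 0 2 (mindex0 d) z t y / 2
  + dird dv 0 3 (mindex0 d) z t y / 6
  + h * (dv 1 (mindex0 d) t y + dird dv 1 1 (mindex0 d) z t y).

(** Expanding first in time at the new point and only then in space at the old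
    one uses no derivative of parabolic order above four. *)
Lemma taylor_step_bound t s y y' : q = 4%N -> 0 <= t -> t < s -> s <= T ->
  D y -> D y' -> v t y' @[t --> T^'-] --> v T y' ->
  `|v s y' - v t y - taylor_step t (s - t) (y' - y) y|
  <= (C * (1 + d%:R ^+ 2 + d%:R ^+ 4)) * (weight m y * weight m y') *
     (`|y' - y| ^+ 4 + (s - t) * `|y' - y| ^+ 2 + (s - t) ^+ 2).
Proof.
move=> q4 t0 ts sT Dy Dy' cvT.
have tI : 0 <= t < T by rewrite t0 (lt_le_trans ts).
have [dv0 _ _ _] := dvP.
have q4' : (4 <= q)%N by rewrite q4.
have h0 : 0 <= s - t by rewrite subr_ge0 ltW.
have C0 : 0 <= C.
  have := bdv (k := 0) (l := mindex0 d); rewrite mdeg_mindex0.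
  move=> /(_ isT t y tI Dy) /(le_trans (normr_ge0 _)).
  by rewrite pmulr_lge0// (lt_le_trans _ (weight_ge1 m y)).
have H1 := @taylor_time_terminal t s y' q4' t0 ts sT Dy' cvT.
have q40 : (2 * 0 + 4 <= q)%N by rewrite q4.
have q42 : (2 * 1 + 2 <= q)%N by rewrite q4.
set z := y' - y.
pose W := weight m y; pose W' := weight m y'.
have H2 : `|v t y' - (v t y + dird dv 0 1 (mindex0 d) z t y
     + dird dv 0 2 (mindex0 d) z t y / 2 + dird dv 0 3 (mindex0 d) z t y / 6)|
    <= (d%:R * `|z|) ^+ 4 * (C * (W * W')).
  have := @taylor_space 0 4 t y y' q40 tI Dy Dy'.
  rewrite -(dv0 t y')// -(dv0 t y)//.
  rewrite 4!big_ord_recl big_ord0 /bump -[dv 0 (mindex0 d) t y]/(dird dv 0 0 (mindex0 d) z t y).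
  rewrite -[((1 + (1 + 0))`!)%N]/2%N -[((1 + (1 + (1 + 0)))`!)%N]/6%N.
  by rewrite !divr1 addr0 !addrA.
have H3 : `|dv 1 (mindex0 d) t y' - (dv 1 (mindex0 d) t y + dird dv 1 1 (mindex0 d) z t y)|
    <= (d%:R * `|z|) ^+ 2 * (C * (W * W')).
  have := @taylor_space 1 2 t y y' q42 tI Dy Dy'.
  rewrite 2!big_ord_recl big_ord0 /bump -[dv 1 (mindex0 d) t y]/(dird dv 1 0 (mindex0 d) z t y).
  by rewrite !divr1 addr0.
have WW' : W' <= W * W' by rewrite ler_peMl ?weight_ge1// weight_ge0.
have split4 : v s y' - v t y - taylor_step t (s - t) z y =
  (v s y' - v t y' - (s - t) * dv 1 (mindex0 d) t y') +
  (v t y' - (v t y + dird dv 0 1 (mindex0 d) z t y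
     + dird dv 0 2 (mindex0 d) z t y / 2 + dird dv 0 3 (mindex0 d) z t y / 6)) +
  (s - t) * (dv 1 (mindex0 d) t y' -
     (dv 1 (mindex0 d) t y + dird dv 1 1 (mindex0 d) z t y)).
  by rewrite /taylor_step; ring.
rewrite split4.
apply: le_trans (ler_normD _ _) _; apply: le_trans (lerD (ler_normD _ _) (lexx _)) _.
rewrite (normrM (s - t)) (ger0_norm h0).
apply: le_trans (lerD (lerD H1 H2) (ler_wpM2l h0 H3)) _.
rewrite -/W -/W' !exprMn.
have CW : C * W' * (s - t) ^+ 2 <= C * (W * W') * (s - t) ^+ 2.
  by rewrite ler_wpM2r ?sqr_ge0// ler_wpM2l.
have P0 : 0 <= C * (W * W') by rewrite !mulr_ge0// weight_ge0.
have d0 : 0 <= d%:R :> R by [].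
set P := C * (W * W') in CW P0 *.
set h := s - t in CW h0 *; set x := `|z|.
have x0 : 0 <= x by rewrite /x.
have -> : C * (1 + d%:R ^+ 2 + d%:R ^+ 4) * (W * W') * (x ^+ 4 + h * x ^+ 2 + h ^+ 2)
  = P * (1 + d%:R ^+ 2 + d%:R ^+ 4) * (x ^+ 4 + h * x ^+ 2 + h ^+ 2).
  by rewrite /P; ring.
have E : P * (1 + d%:R ^+ 2 + d%:R ^+ 4) * (x ^+ 4 + h * x ^+ 2 + h ^+ 2) -
  (P * h ^+ 2 + d%:R ^+ 4 * x ^+ 4 * P + h * (d%:R ^+ 2 * x ^+ 2 * P)) =
  P * ((1 + d%:R ^+ 2) * x ^+ 4 + (1 + d%:R ^+ 4) * (h * x ^+ 2)
       + (d%:R ^+ 2 + d%:R ^+ 4) * h ^+ 2) by ring.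
have : 0 <= P * ((1 + d%:R ^+ 2) * x ^+ 4 + (1 + d%:R ^+ 4) * (h * x ^+ 2)
       + (d%:R ^+ 2 + d%:R ^+ 4) * h ^+ 2).
  by rewrite mulr_ge0// !addr_ge0// mulr_ge0// ?addr_ge0// ?mulr_ge0// ?exprn_ge0.
rewrite -E subr_ge0; apply: le_trans.
by rewrite !lerD2r.
Qed.

End OneFamily.
End BoundaryExtension.

(** * Uniqueness of the derivatives, and Borel functions on R^d *)

Section Uniqueness.
Variables (R : realType) (d : nat) (T : R) (D O : set 'cV[R]_d) (o : 'cV[R]_d).
Hypothesis T0 : 0 < T.
Hypothesis oO : open O.
Hypothesis OD : O `<=` D.
Hypothesis cO : segment_closed O.
Hypothesis DO : D `<=` closure O.
Hypothesis Oo : O o.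
Variables (q q' : nat) (v : R -> 'cV[R]_d -> R).
Variables dv du : nat -> multi_index d -> R -> 'cV[R]_d -> R.
Hypothesis dvP : pderivs T D q v dv.
Hypothesis duP : pderivs T D q' v du.
Hypothesis qq' : (q' <= q)%N.

(** Two families of derivatives of the same function, given up to different
    orders, coincide: derivatives in the open set are unique, so agreement passes
    from one index to the next ones. *)
Definition agree_inside k (a : multi_index d) :=
  forall (t : R) y, 0 < t < T -> O y -> dv k a t y = du k a t y.

Lemma agree_inside0 : agree_inside 0 (mindex0 d).
Proof.
move=> t y /andP[t0 tT] Oy.
have [e1 _ _ _] := dvP; have [e2 _ _ _] := duP.
by rewrite e1 ?e2 ?(ltW t0)//; exact: OD.
Qed.

Lemma agree_inside_space k a i : (2 * k + (mdeg a).+1 <= q')%N ->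
  agree_inside k a -> agree_inside k (mincr a i).
Proof.
move=> kq H t y tI Oy.
have Oi : O `<=` D° by exact: O_interior.
have [_ _ _ dvd] := dvP; have [_ _ _ dud] := duP.
have [_ <-] := dvd k a i t y (leq_trans kq qq') tI (Oi _ Oy).
have H2 := dud k a i t y kq tI (Oi _ Oy).
have : is_derive y (delta_mx i 0 : 'cV[R]_d) (dv k a t) (du k (mincr a i) t y).
  apply: near_eq_is_derive H2; near=> x; apply/esym/H => //.
  by near: x; exact: open_nbhs_nbhs.
by case.
Unshelve. all: by end_near. Qed.

Lemma agree_inside_time k a : (2 * k.+1 + mdeg a <= q')%N ->
  agree_inside k a -> agree_inside k.+1 a.
Proof.
move=> kq H t y tI Oy.
have Oi : O `<=` D° by exact: O_interior.
have [_ _ dvd _] := dvP; have [_ _ dud _] := duP.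
have [_ <-] := dvd k a t y (leq_trans kq qq') tI (Oi _ Oy).
have H2 := dud k a t y kq tI (Oi _ Oy).
have : is_derive t (1 : R) (fun s => dv k a s y) (du k.+1 a t y).
  have /andP[t0 tT] := tI.
  apply: near_eq_is_derive H2; near=> x; apply/esym/H => //.
  apply/andP; split; near: x; [exact: lt_nbhsr|exact: lt_nbhsl].
by case.
Unshelve. all: by end_near. Qed.

(** On the boundary the derivatives are limits of their values inside. *)
Lemma agree_closure k a (t : R) y : (2 * k + mdeg a <= q')%N -> agree_inside k a ->
  0 <= t < T -> D y -> dv k a t y = du k a t y.
Proof.
move=> kq H tI Dy.
have H1 := @cvg_dv_inward _ _ _ _ _ _ T0 oO OD cO DO Oo q v dv dvP k a t y
  (leq_trans kq qq') tI Dy.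
have H2 := @cvg_dv_inward _ _ _ _ _ _ T0 oO OD cO DO Oo q' v du duP k a t y kq tI Dy.
apply: (@cvg_unique _ (@Rhausdorff R) _ _ _ _ H1).
apply: cvg_trans H2; apply: near_eq_cvg.
apply: filterS (near_inward R) => e e01; apply/esym/H.
  exact: inward_time_lt.
exact: (inward_open oO cO DO Oo).
Qed.

End Uniqueness.

Section BorelFunctions.
Variables (R : realType) (d : nat).
Implicit Types (D O : set 'cV[R]_d).

(** A measurable type whose measurable sets are those of [borel], so that the
    stability properties of measurable functions apply to [borel_on]. *)
Definition borel_space := g_sigma_algebraType (@open 'cV[R]_d).

Lemma borelE (B : set 'cV[R]_d) : borel B = measurable (B : set borel_space).
Proof. by []. Qed.

Lemma open_borel O : open O -> borel O.
Proof. exact: sub_sigma_algebra. Qed.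

Lemma convex_domain_or_closure_borel D : convex_domain_or_closure D -> borel D.
Proof.
move=> [U [_ oU _] [-> | ->]]; first exact: open_borel.
rewrite -[closure U]setCK borelE; apply: measurableC.
by apply: open_borel; rewrite openC; exact: closed_closure.
Qed.

Lemma borel_onE D (g : 'cV[R]_d -> R) : borel D ->
  borel_on D g <-> measurable_fun (D : set borel_space) g.
Proof. by move=> bD; split => [H _|H B mB]; [exact: H|exact: (H bD)]. Qed.

Lemma within_continuous_measurable D (g : 'cV[R]_d -> R) : borel D ->
  {within D, continuous g} -> measurable_fun (D : set borel_space) g.
Proof.
move=> bD cg.
apply: (@measurability _ _ borel_space _ _ _ _ (RGenOpens.measurableE R)).
move=> _ [_ [a [b ->] <-]].
have /open_subspaceP[V oV VD] : open ((g : subspace D -> R) @^-1` `]a, b[).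
  by move/continuousP : cg; apply; exact: interval_open.
rewrite setIC -VD; apply: measurableI => //; exact: open_borel.
Qed.
End BorelFunctions.

(** * Means and conditional expectations *)

Section Means.
Context (R : realType) (disp : measure_display) (Om : measurableType disp).
Variable P : probability Om R.
Implicit Types (f g X Z : Om -> R) (c : R).

Local Notation rv f := (P.-integrable setT (EFin \o f)).

Lemma rv_measurable f : rv f -> measurable_fun setT f.
Proof. by move=> /measurable_int /measurable_EFinP. Qed.

Lemma rvD f g : rv f -> rv g -> rv (fun w => f w + g w).
Proof. by move=> rf rg; have := integrableD measurableT rf rg. Qed.

Lemma rvZ c f : rv f -> rv (fun w => c * f w).
Proof. by move=> rf; have := integrableZl measurableT c rf. Qed.

Lemma rvB f g : rv f -> rv g -> rv (fun w => f w - g w).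
Proof. by move=> rf rg; have := integrableB measurableT rf rg. Qed.

Lemma rv_cst c : rv (fun=> c).
Proof. exact: finite_measure_integrable_cst. Qed.

Lemma rv_le f g : measurable_fun setT f -> (forall w, `|f w| <= g w) -> rv g -> rv f.
Proof.
move=> mf fg; apply: le_integrable => //; first exact/measurable_EFinP.
by move=> w _; rewrite /= lee_fin (le_trans (fg w))// ler_norm.
Qed.

Lemma rv_boundedM f g c : measurable_fun setT f -> (forall w, `|f w| <= c) ->
  rv g -> rv (fun w => f w * g w).
Proof.
move=> mf fc rg; apply: (rv_le (g := fun w => c * `|g w|)).
- exact/(measurable_funM mf)/rv_measurable.
- by move=> w; rewrite normrM ler_wpM2r.
- exact/rvZ/integrable_norm.
Qed.

Lemma mean_norm_le f g : measurable_fun setT f -> (forall w, `|f w| <= g w) ->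
  rv g -> `|\int[P]_w f w| <= \int[P]_w g w.
Proof.
move=> mf fg rg; have rf := rv_le mf fg rg.
apply: le_trans (le_normr_Rintegral measurableT rf) _.
by apply: le_Rintegral => //; exact: integrable_norm.
Qed.

(** Integrability is part of the relation, which makes it stable under linear
    combinations. *)
Definition same_mean X Z := [/\ rv X, rv Z & \int[P]_w X w = \int[P]_w Z w].

Lemma same_mean_refl X : rv X -> same_mean X X.
Proof. by []. Qed.

Lemma same_meanD X Z X' Z' : same_mean X Z -> same_mean X' Z' ->
  same_mean (fun w => X w + X' w) (fun w => Z w + Z' w).
Proof.
move=> [rX rZ e] [rX' rZ' e']; split; try exact: rvD.
by rewrite !RintegralD// e e'.
Qed.

Lemma same_meanZ c X Z : same_mean X Z ->
  same_mean (fun w => c * X w) (fun w => c * Z w).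
Proof. by move=> [rX rZ e]; split; try exact: rvZ; rewrite !RintegralZl// e. Qed.

Lemma same_mean_sum (I : Type) (s : seq I) (X Z : I -> Om -> R) :
  (forall i, same_mean (X i) (Z i)) ->
  same_mean (fun w => \sum_(i <- s) X i w) (fun w => \sum_(i <- s) Z i w).
Proof.
move=> H; elim: s => [|i s IH].
  by under eq_fun do rewrite big_nil; under [X in same_mean _ X]eq_fun do rewrite big_nil; apply/same_mean_refl/rv_cst.
under eq_fun do rewrite big_cons; under [X in same_mean _ X]eq_fun do rewrite big_cons.
exact: same_meanD.
Qed.

(** Write theta, with values in [0, 1], as half the indicator of theta >= 1/2 plus
    half of another such function. The indicator contributes 0, so a bound on
    all these means can be halved, again and again, and they are zero. *)
Lemma mean_vanish (G : set (set Om)) (phi X : Om -> R) :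
  rv X -> measurable_fun setT phi ->
  (forall B : set R, measurable B -> G (phi @^-1` B)) ->
  (forall A, G A -> \int[P]_(w in A) X w = 0) ->
  forall theta : R -> R, measurable_fun setT theta ->
    (forall x, 0 <= theta x <= 1) ->
  \int[P]_w (theta (phi w) * X w) = 0.
Proof.
move=> rX mphi Gphi GX theta mtheta theta01.
have halve n : forall theta : R -> R, measurable_fun setT theta ->
    (forall x, 0 <= theta x <= 1) ->
    `|\int[P]_w (theta (phi w) * X w)| <= 2^-1 ^+ n * \int[P]_w `|X w|.
  elim: n => [|n IH] th mth th01.
    rewrite expr0 mul1r; apply: mean_norm_le.
    - apply: measurable_funM; first exact: measurableT_comp.
      exact: rv_measurable.
    - move=> w; have /andP[t0 t1] := th01 (phi w).
      by rewrite normrM ger0_norm// ler_piMl.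
    - exact: integrable_norm.
  pose A := th @^-1` `[2^-1, +oo[.
  have mA : measurable A by rewrite -[A]setTI; apply: mth => //; exact: measurable_itv.
  pose th' x := 2 * th x - \1_A x.
  have mth' : measurable_fun setT th'.
    apply: measurable_funB; last exact: measurable_indic.
    exact: measurable_funM.
  have th'01 x : 0 <= th' x <= 1.
    rewrite /th' indicE; have /andP[t0 t1] := th01 x.
    have [xA|xA] := boolP (x \in A).
      move: xA; rewrite inE /A/= in_itv/= andbT => ?; rewrite /=; lra.
    move: xA; rewrite notin_setE /A/= in_itv/= andbT => /negP; rewrite -ltNge => ?.
    by rewrite /=; lra.
  have E w : th (phi w) * X w =
      2^-1 * (\1_(phi @^-1` A) w * X w) + 2^-1 * (th' (phi w) * X w).
    have -> : \1_(phi @^-1` A) w = \1_A (phi w) :> R.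
      by rewrite !indicE.
    by rewrite /th'; field.
  have mG : measurable (phi @^-1` A) by rewrite -[X in measurable X]setTI; exact: mphi.
  have r1 : rv (fun w => \1_(phi @^-1` A) w * X w).
    apply: (rv_boundedM (c := 1)) => // w.
    by rewrite indicE; case: (_ \in _); rewrite ?normr1 ?normr0.
  have r2 : rv (fun w => th' (phi w) * X w).
    apply: (rv_boundedM (c := 1)) => //; first exact: measurableT_comp.
    by move=> w; have /andP[t0 t1] := th'01 (phi w); rewrite ger0_norm.
  have -> : \int[P]_w (th (phi w) * X w) =
      \int[P]_w (2^-1 * (\1_(phi @^-1` A) w * X w) + 2^-1 * (th' (phi w) * X w)).
    by apply: eq_Rintegral => w _; exact: E.
  rewrite RintegralD//; [|exact: rvZ..].
  rewrite !RintegralZl//.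
  have -> : \int[P]_w (\1_(phi @^-1` A) w * X w) = 0.
    rewrite -[RHS](GX _ (Gphi _ mA)) [RHS]Rintegral_mkcond; apply: eq_Rintegral => w _.
    by rewrite patchE indicE; case: ifPn; rewrite ?mul1r ?mul0r.
  rewrite mulr0 add0r normrM ger0_norm// exprS -mulrA ler_wpM2l//.
  exact: IH.
have I0 : 0 <= \int[P]_w `|X w| by apply: Rintegral_ge0.
apply/eqP; rewrite -normr_eq0 eq_le normr_ge0 andbT.
have cv : (2^-1 : R) ^+ n * \int[P]_w `|X w| @[n --> \oo] --> (0 : R).
  rewrite -[X in _ --> X](mul0r (\int[P]_w `|X w|)).
  apply: cvgM; last exact: cvg_cst.
  by apply: cvg_expr; rewrite ger0_norm// invf_lt1// ltr1n.
apply: (ler_cvg_to (@cvg_cst _ _ _ _ _) cv).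
by apply: nearW => n; exact: halve.
Qed.

(** An affine change of variables brings phi into [0, 1], where [mean_vanish]
    applies to X - Z; the minimum and the maximum in theta only make it take
    its values in [0, 1] on the whole line. *)
Lemma condexp_bounded (G : set (set Om)) X Z (phi : Om -> R) c :
  is_condexp P G X Z -> G `<=` measurable ->
  (forall B : set R, measurable B -> G (phi @^-1` B)) ->
  (forall w, `|phi w| <= c) ->
  same_mean (fun w => phi w * X w) (fun w => phi w * Z w).
Proof.
move=> [rX rZ _ GXZ] Gm Gphi phic.
have mphi : measurable_fun setT phi.
  by move=> _ B mB; rewrite setTI; exact/Gm/Gphi.
split; try exact: (rv_boundedM mphi phic).
have rD := rvB rX rZ.
have GD A : G A -> \int[P]_(w in A) (X w - Z w) = 0.
  move=> GA; have mA := Gm _ GA.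
  rewrite RintegralB//; try by apply: (integrableS measurableT).
  by rewrite /Rintegral GXZ// subrr.
pose k := `|c| + 1.
have k0 : 0 < k by rewrite /k ltr_wpDl.
pose theta (x : R) := Num.max 0 (Num.min 1 ((x / k + 1) / 2)).
have mtheta : measurable_fun setT theta.
  apply: measurable_maxr => //; apply: measurable_minr => //.
  apply: measurable_funM => //; apply: measurable_funD => //; exact: measurable_funM.
have theta01 x : 0 <= theta x <= 1.
  by rewrite /theta le_max lexx /= ge_max ler01 ge_min lexx.
have thetaE w : theta (phi w) = (phi w / k + 1) / 2.
  have : `|phi w / k| <= 1.
    rewrite normrM normfV (gtr0_norm k0) ler_pdivrMr// mul1r (le_trans (phic w))//.
    by rewrite /k (le_trans (ler_norm c))// lerDl.
  rewrite ler_norml => /andP[h1 h2].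
  rewrite /theta min_r ?max_r//; lra.
have V1 := mean_vanish rD mphi Gphi GD mtheta theta01.
have V2 : \int[P]_w (X w - Z w) = 0.
  have := GD setT; apply; have := Gphi setT measurableT; by rewrite preimage_setT.
apply/eqP; rewrite -subr_eq0 -RintegralB//; try exact: (rv_boundedM mphi phic).
have -> : \int[P]_w (phi w * X w - phi w * Z w) =
   \int[P]_w ((2 * k) * (theta (phi w) * (X w - Z w)) - k * (X w - Z w)).
  by apply: eq_Rintegral => w _; rewrite thetaE; field; rewrite lt0r_neq0.
have rt : rv (fun w => theta (phi w) * (X w - Z w)).
  apply: (rv_boundedM (c := 1)) => //; first exact: measurableT_comp.
  by move=> w; have /andP[t0 t1] := theta01 (phi w); rewrite ger0_norm.
rewrite RintegralB//; [|exact: rvZ..].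
by rewrite !RintegralZl// V1 V2 !mulr0 subrr.
Qed.

End Means.

(** * Moment bounds *)

Section EuclideanNorm.
Variable R : realType.

Lemma enorm_ge0 m n (A : 'M[R]_(m, n)) : 0 <= enorm A.
Proof. exact: sqrtr_ge0. Qed.

Lemma coord_le_enorm m n (A : 'M[R]_(m, n)) i j : `|A i j| <= enorm A.
Proof.
rewrite /enorm -sqrtr_sqr ler_wsqrtr// (bigD1 i)//= (bigD1 j)//=.
rewrite -addrA lerDl addr_ge0// ?sumr_ge0// => [*|k _]; first exact: sqr_ge0.
by apply: sumr_ge0 => *; exact: sqr_ge0.
Qed.

Lemma norm_le_enorm m n (A : 'M[R]_(m, n)) : `|A| <= enorm A.
Proof.
rewrite [leLHS]mx_normrE; apply: bigmax_le; first exact: enorm_ge0.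
by move=> ij _; exact: coord_le_enorm.
Qed.

Lemma enorm_le_norm d (y : 'cV[R]_d) : enorm y <= d%:R * `|y|.
Proof.
have dy : 0 <= d%:R * `|y| by rewrite mulr_ge0.
rewrite /enorm -[leRHS]ger0_norm// -sqrtr_sqr ler_wsqrtr//.

apply: (@le_trans _ _ (\sum_(i < d) `|y| ^+ 2)).
  apply: ler_sum => i _; rewrite big_ord1 -[leLHS]real_normK ?num_real//.
  by rewrite lerXn2r ?nnegrE// norm_coord_le.
rewrite sumr_const card_ord -[leLHS]mulr_natl exprMn ler_wpM2r ?exprn_ge0//.
by rewrite -natrX ler_nat; case: (d) => // n; rewrite expnS expn1 leq_pmulr.
Qed.

End EuclideanNorm.

Section MeanBounds.
Context (R : realType) (disp : measure_display) (Om : measurableType disp).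
Variable P : probability Om R.
Implicit Types (f g : Om -> R) (c k : R).

Local Notation rv f := (P.-integrable setT (EFin \o f)).

(** The integral is taken in the extended reals: the bound then contains the
    integrability of g. *)
Definition mean_le g c : Prop :=
  [/\ measurable_fun setT g, forall w, 0 <= g w &
      (\int[P]_w (g w)%:E <= c%:E)%E].

Lemma mean_le_rv g c : mean_le g c -> rv g.
Proof.
move=> [mg g0 gc]; apply/integrableP; split; first exact/measurable_EFinP.
under eq_integral do rewrite /= ger0_norm//.
exact: le_lt_trans gc (ltry _).
Qed.

Lemma mean_leP g c : mean_le g c -> \int[P]_w g w <= c.
Proof.
move=> gc; have rg := mean_le_rv gc; have [_ _ H] := gc.
by rewrite -lee_fin fineK//; exact: integrable_fin_num.
Qed.

Lemma mean_le_dom f g c : mean_le g c -> measurable_fun setT f ->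
  (forall w, 0 <= f w <= g w) -> mean_le f c.
Proof.
move=> [mg g0 gc] mf fg; split => //; first by move=> w; have /andP[] := fg w.
apply: le_trans gc; apply: ge0_le_integral => //.
- by move=> w _; rewrite lee_fin; have /andP[] := fg w.
- exact/measurable_EFinP.
- exact/measurable_EFinP.
- by move=> w _; rewrite lee_fin; have /andP[] := fg w.
Qed.

Lemma mean_le_cst c : 0 <= c -> mean_le (fun=> c) c.
Proof.
move=> c0; split=> //.
rewrite integral_cst// -[leRHS]mule1 lee_wpmul2l//.
exact: probability_le1.
Qed.

Lemma mean_leD f g c c' : mean_le f c -> mean_le g c' ->
  mean_le (fun w => f w + g w) (c + c').
Proof.
move=> [mf f0 fc] [mg g0 gc]; split; first exact: measurable_funD.
  by move=> w; rewrite addr_ge0.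
under eq_integral do rewrite EFinD.
rewrite ge0_integralD//; try exact/measurable_EFinP; try by move=> w _; rewrite lee_fin.
by rewrite EFinD leeD.
Qed.

Lemma mean_leZ k g c : 0 <= k -> mean_le g c -> mean_le (fun w => k * g w) (k * c).
Proof.
move=> k0 [mg g0 gc]; split; first exact: measurable_funM.
  by move=> w; rewrite mulr_ge0.
under eq_integral do rewrite EFinM.
rewrite ge0_integralZl//; try exact/measurable_EFinP; try by move=> w _; rewrite lee_fin.
by rewrite EFinM lee_wpmul2l// lee_fin.
Qed.

Lemma mean_le_sum n (g : 'I_n -> Om -> R) c : (forall i, mean_le (g i) c) ->
  mean_le (fun w => \sum_i g i w) (n%:R * c).
Proof.
move=> gc.
elim: n g gc => [|n IH] g gc.
  under eq_fun do rewrite big_ord0.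
  by rewrite mul0r; exact: mean_le_cst.
under eq_fun do rewrite big_ord_recl.
by rewrite -natr1 addrC mulrDl mul1r; apply: mean_leD => //; exact: IH.
Qed.

Lemma mean_le_sqM f g c c' :
  mean_le (fun w => f w ^+ 2) c -> mean_le (fun w => g w ^+ 2) c' ->
  measurable_fun setT f -> measurable_fun setT g ->
  (forall w, 0 <= f w) -> (forall w, 0 <= g w) ->
  mean_le (fun w => f w * g w) (c + c').
Proof.
move=> fc gc mf mg f0 g0; apply: mean_le_dom (mean_leD fc gc) _ _.
  exact: measurable_funM.
move=> w; rewrite mulr_ge0//= -subr_ge0.
have -> : f w ^+ 2 + g w ^+ 2 - f w * g w =
  ((f w - g w) ^+ 2 + f w ^+ 2 + g w ^+ 2) / 2 by field.
by rewrite divr_ge0// !addr_ge0// sqr_ge0.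
Qed.

Lemma Lnorm_moment (p : R) g c : 0 < p -> 0 <= c -> measurable_fun setT g ->
  (forall w, 0 <= g w) ->
  ('N[P]_(p%:E)[(fun w => (g w)%:E)] <= c%:E)%E ->
  mean_le (fun w => g w `^ p) (c `^ p).
Proof.
move=> p0 c0 mg g0 H; split.
- exact: (measurableT_comp (measurable_powR p)).
- by move=> w; exact: powR_ge0.
have := powR_Lnorm P (fun w => (g w)%:E) (lt0r_neq0 p0).
under [X in _ = X -> _]eq_integral do rewrite /= ger0_norm//.
move=> <-; rewrite -poweR_EFin; apply: gt0_ler_poweR => //.
- exact: ltW.
- by rewrite in_itv/= Lnorm_ge0 leey.
- by rewrite in_itv/= lee_fin c0 leey.
Qed.

Lemma Lnorm_moment_nat (p : nat) g c : (0 < p)%N -> 0 <= c ->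
  measurable_fun setT g -> (forall w, 0 <= g w) ->
  ('N[P]_((p%:R : R)%:E)[(fun w => (g w)%:E)] <= c%:E)%E ->
  mean_le (fun w => g w ^+ p) (c ^+ p).
Proof.
move=> p0 c0 mg g0 H.
have p0' : 0 < p%:R :> R by rewrite ltr0n.
have := Lnorm_moment p0' c0 mg g0 H; rewrite powR_mulrn//.
by under eq_fun do rewrite powR_mulrn//.
Qed.

(** Young's inequality, scaled by the size e of g, in the role of Hoelder's. *)
Lemma mean_le_young (p q e c M : R) g (V : Om -> R) : 1 < p -> p^-1 + q^-1 = 1 -> 0 < e ->
  measurable_fun setT g -> measurable_fun setT V ->
  (forall w, 0 <= g w) -> (forall w, 0 <= V w) -> 0 <= c ->
  mean_le (fun w => g w `^ p) ((c * e) `^ p) ->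
  mean_le (fun w => V w `^ q) M ->
  mean_le (fun w => V w * g w) (e * (c `^ p + M)).
Proof.
move=> p1 pq e0 mg mV g0 V0 c0 gc VM.
have p0 : 0 < p := lt_trans ltr01 p1.
have q0 : 0 < q.
  by rewrite -invr_gt0 -(addKr p^-1 q^-1) pq addrC subr_gt0 invf_lt1.
have q1 : 1 <= q.
  rewrite -(invrK q) invf_ge1 ?invr_gt0// -pq lerDr invr_ge0 ltW//.
have ep : 0 < e `^ p by exact: powR_gt0.
have -> : c `^ p = (e `^ p)^-1 * (c * e) `^ p.
  by rewrite powRM// ?(ltW e0)// mulrCA mulVf ?mulr1// lt0r_neq0.
apply: mean_le_dom (mean_leZ (ltW e0) (mean_leD (mean_leZ _ gc) VM)) _ _.
- by rewrite invr_ge0 powR_ge0.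
- exact: measurable_funM.
- move=> w; rewrite mulr_ge0//=.
  have -> : V w * g w = e * ((g w / e) * V w) by field; rewrite lt0r_neq0.
  rewrite ler_wpM2l ?(ltW e0)//.
  have ge : 0 <= g w / e by rewrite divr_ge0// ltW.
  apply: le_trans (conjugate_powR ge (V0 w) p0 q0 pq) _.
  apply: lerD.
    have -> : (e `^ p)^-1 * g w `^ p = (g w / e) `^ p.
      rewrite mulrC powRM// ?invr_ge0 ?(ltW e0)//; congr (_ * _).
      apply: (mulIf (lt0r_neq0 ep)); rewrite mulVf ?lt0r_neq0//.
      by rewrite -powRM ?invr_ge0 ?(ltW e0)// mulVf ?powR1// lt0r_neq0.
    by rewrite ler_pdivrMr// ler_peMr ?powR_ge0// ltW.
  by rewrite ler_pdivrMr// ler_peMr ?powR_ge0.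
Qed.

End MeanBounds.

(** * Replacing the increment by its conditional moments *)

Section RandomVectors.
Context (R : realType) (disp : measure_display) (Om : measurableType disp).
Variables (P : probability Om R) (d : nat).
Implicit Types (Y : Om -> 'cV[R]_d) (D : set 'cV[R]_d) (g : 'cV[R]_d -> R).

Definition random_vector Y := sigma_of Y `<=` measurable.

Lemma sigma_of_comp D Y g B : borel_on D g -> (forall w, D (Y w)) ->
  measurable B -> sigma_of Y ((g \o Y) @^-1` B).
Proof.
move=> bg DY mB; exists (D `&` g @^-1` B); first exact: bg.
by apply/seteqP; split => w /=; [case|].
Qed.

Lemma random_vector_comp D Y g : random_vector Y -> borel_on D g ->
  (forall w, D (Y w)) -> measurable_fun setT (g \o Y).
Proof.
by move=> mY bg DY _ B mB; rewrite setTI; exact/mY/(sigma_of_comp bg).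
Qed.

Lemma continuous_borel_on g D : borel D -> continuous g -> borel_on D g.
Proof.
move=> bD cg; apply/borel_onE => //; apply: within_continuous_measurable => //.
exact: continuous_subspaceT.
Qed.

Lemma random_vector_continuous Y g : random_vector Y -> continuous g ->
  measurable_fun setT (g \o Y).
Proof.
move=> mY cg; apply: (@random_vector_comp setT) => //.
by apply: continuous_borel_on => //; exact: (@measurableT _ (borel_space R d)).
Qed.

Lemma random_vector_coord Y i : random_vector Y -> measurable_fun setT (fun w => Y w i 0).
Proof.
by move=> mY; exact: (random_vector_continuous mY (@coord_continuous _ _ _ i 0)).
Qed.

Lemma measurable_weight m Y : random_vector Y ->
  measurable_fun setT (fun w => weight m (Y w)).
Proof.
move=> mY; apply: measurable_funX; apply: measurable_funD => //.
apply: (random_vector_continuous mY); exact: norm_continuous.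
Qed.

Lemma measurable_enorm m n (A : Om -> 'M[R]_(m, n)) :
  (forall i j, measurable_fun setT (fun w => A w i j)) ->
  measurable_fun setT (fun w => enorm (A w)).
Proof.
move=> mA.
have : measurable_fun setT (fun w => \sum_i \sum_j A w i j ^+ 2).
  apply: measurable_sum => i; apply: measurable_sum => j.
  exact: measurable_funX.
apply: measurableT_comp; apply: continuous_measurable_fun.
exact: sqrt_continuous.
Qed.

Lemma expr1D_le (r : R) n : 0 <= r -> (1 + r) ^+ n <= 2 ^+ n * (1 + r ^+ n).
Proof.
move=> r0; have rn0 : 0 <= r ^+ n by exact: exprn_ge0.
have [r1|r1] := leP r 1.
  apply: (@le_trans _ _ (2 ^+ n)).
    rewrite lerXn2r ?nnegrE ?addr_ge0//; lra.
  by rewrite ler_peMr ?exprn_ge0// lerDl.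
apply: (@le_trans _ _ (2 ^+ n * r ^+ n)).
  rewrite -exprMn lerXn2r ?nnegrE ?addr_ge0 ?mulr_ge0//; lra.
by rewrite ler_wpM2l ?exprn_ge0// lerDr.
Qed.

Lemma weightD m n (y : 'cV[R]_d) : weight (m + n) y = weight m y * weight n y.
Proof. by rewrite /weight exprD. Qed.

Lemma weight_le m n (y : 'cV[R]_d) : (m <= n)%N -> weight m y <= weight n y.
Proof. by move=> mn; rewrite /weight ler_weXn2l// lerDl. Qed.

Definition weight_mean (c : R) m : R := 2 ^+ m.+2 * (1 + c ^+ m.+2).

(** The exponent m + 2 exceeds 1 for every m, as the moment bounds require. *)
Lemma weight_moment m Y (c : R) : random_vector Y -> 0 <= c ->
  ('N[P]_(m.+2%:R%:E)[(fun w => (enorm (Y w))%:E)] <= c%:E)%E ->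
  mean_le P (fun w => weight m (Y w)) (weight_mean c m).
Proof.
move=> mY c0 Hc.
have me : measurable_fun setT (fun w => enorm (Y w)).
  apply: measurable_enorm => i j; rewrite [j]ord1; exact: random_vector_coord.
have Hm := Lnorm_moment_nat (isT : (0 < m.+2)%N) c0 me (fun w => enorm_ge0 _) Hc.
apply: mean_le_dom (mean_leZ _ (mean_leD (mean_le_cst P ler01) Hm)) _ _.
- by rewrite exprn_ge0.
- exact: measurable_weight.
- move=> w; rewrite weight_ge0/=; apply: le_trans (expr1D_le _ (enorm_ge0 _)).
  apply: le_trans (weight_le _ (_ : (m <= m.+2)%N)) _; first by rewrite -addn2 leq_addr.
  by rewrite /weight lerXn2r ?nnegrE ?addr_ge0 ?enorm_ge0// lerD2l norm_le_enorm.
Qed.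

End RandomVectors.

Section OneStep.
Context (R : realType) (disp : measure_display) (Om : measurableType disp).
Variables (P : probability Om R) (d : nat) (D : set 'cV[R]_d).
Hypothesis bD : borel D.
Variables (Y Y' : Om -> 'cV[R]_d).
Hypotheses (mY : random_vector Y) (mY' : random_vector Y').
Hypotheses (DY : forall w, D (Y w)) (DY' : forall w, D (Y' w)).
Variable dv : nat -> multi_index d -> R -> 'cV[R]_d -> R.
Variables (t h : R).
Implicit Types (w : Om) (y : 'cV[R]_d).

Local Notation rv f := (P.-integrable setT (EFin \o f)).
Local Notation m0 := (mindex0 d).
Local Notation d1 i := (mincr m0 i).
Local Notation d2 i j := (mincr (mincr m0 i) j).
Local Notation d3 i j k := (mincr (mincr (mincr m0 i) j) k).

(** The Taylor polynomial of one step, as a function of the first three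
    moments of the increment, which can be replaced by conditional ones. *)
Definition moment_step (X1 : 'I_d -> R) (X2 : 'I_d -> 'I_d -> R)
    (X3 : 'I_d -> 'I_d -> 'I_d -> R) y : R :=
  \sum_i dv 0 (d1 i) t y * X1 i
  + 2^-1 * (\sum_i \sum_j dv 0 (d2 i j) t y * X2 i j)
  + 6^-1 * (\sum_i \sum_j \sum_k dv 0 (d3 i j k) t y * X3 i j k)
  + h * (dv 1 m0 t y + \sum_i dv 1 (d1 i) t y * X1 i).

Lemma taylor_stepE (z : 'cV[R]_d) y :
  taylor_step dv t h z y =
  moment_step (fun i => z i 0) (fun i j => z i 0 * z j 0)
    (fun i j k => z i 0 * z j 0 * z k 0) y.
Proof.
rewrite /taylor_step /moment_step /=; congr (_ + _ + _ + _ * (_ + _)).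
- by apply: eq_bigr => i _; rewrite mulrC.
- rewrite [LHS]mulrC; congr (_ * _); apply: eq_bigr => i _; rewrite mulr_sumr.
  by apply: eq_bigr => j _; rewrite mulrA mulrC.
- rewrite [LHS]mulrC; congr (_ * _); apply: eq_bigr => i _; rewrite mulr_sumr.
  apply: eq_bigr => j _; rewrite mulrA mulr_sumr; apply: eq_bigr => k _.
  by rewrite mulrA mulrC.
- by apply: eq_bigr => i _; rewrite mulrC.
Qed.

Lemma moment_stepZ (e : R) X1 X2 X3 y : e * moment_step X1 X2 X3 y =
  \sum_i (e * dv 0 (d1 i) t y) * X1 i
  + 2^-1 * (\sum_i \sum_j (e * dv 0 (d2 i j) t y) * X2 i j)
  + 6^-1 * (\sum_i \sum_j \sum_k (e * dv 0 (d3 i j k) t y) * X3 i j k)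
  + h * (e * dv 1 m0 t y + \sum_i (e * dv 1 (d1 i) t y) * X1 i).
Proof.
rewrite /moment_step 3![e * (_ + _)]mulrDr.
rewrite ![e * (_^-1 * _)]mulrCA ![e * (h * _)]mulrCA.
congr (_ + _ + _ + _).
- by rewrite mulr_sumr; apply: eq_bigr => i _; rewrite mulrA.
- congr (_ * _); rewrite mulr_sumr; apply: eq_bigr => i _; rewrite mulr_sumr.
  by apply: eq_bigr => j _; rewrite mulrA.
- congr (_ * _); rewrite mulr_sumr; apply: eq_bigr => i _; rewrite mulr_sumr.
  apply: eq_bigr => j _; rewrite mulr_sumr; apply: eq_bigr => k _.
  by rewrite mulrA.
- rewrite mulrDr mulr_sumr; congr (_ * (_ + _)).
  by apply: eq_bigr => i _; rewrite mulrA.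
Qed.

Variables (C : R) (m : nat).
Hypothesis dv_borel : forall k a, (2 * k + mdeg a <= 4)%N -> borel_on D (dv k a t).
Hypothesis bdv : forall k a, (2 * k + mdeg a <= 4)%N -> forall y, D y ->
  `|dv k a t y| <= C * weight m y.

(** On a ball the derivatives, of polynomial growth, are bounded, and a bounded
    factor can be taken out of a conditional expectation without any joint
    integrability of the factor and the increment. *)
Definition cutoff (n : nat) y : R := \1_[set y : 'cV[R]_d | `|y| <= n%:R] y.

Lemma cutoff01 n y : 0 <= cutoff n y <= 1.
Proof. by rewrite /cutoff indicE; case: (_ \in _); rewrite /= ?lexx ?ler01. Qed.

Lemma cutoff_borel n : borel_on D (cutoff n).
Proof.
apply/borel_onE => //; apply: measurable_funTS; apply: measurable_indic.
rewrite -[X in measurable X]setCK; apply: measurableC; apply: open_borel.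
rewrite openC; apply: (@closed_comp _ _ (fun y : 'cV[R]_d => `|y|) [set r | r <= n%:R]).
  by move=> y _; exact: norm_continuous.
exact: closed_le.
Qed.

Lemma same_mean_cutoff n k a X Z : (2 * k + mdeg a <= 4)%N ->
  is_condexp P (sigma_of Y) X Z ->
  same_mean P (fun w => (cutoff n (Y w) * dv k a t (Y w)) * X w)
              (fun w => (cutoff n (Y w) * dv k a t (Y w)) * Z w).
Proof.
move=> ka XZ.
have C0 : 0 <= C * weight m (Y point).
  exact: le_trans (normr_ge0 _) (bdv ka (DY _)).
have {}C0 : 0 <= C.
  by move: C0; rewrite pmulr_lge0// (lt_le_trans _ (weight_ge1 m _)).
have bg : borel_on D (fun y => cutoff n y * dv k a t y).
  apply/borel_onE => //; apply: measurable_funM; apply/borel_onE => //.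
    exact: cutoff_borel.
  exact: dv_borel.
apply: (condexp_bounded (c := C * (1 + n%:R) ^+ m) XZ mY).
  by move=> B mB; exact: (sigma_of_comp bg DY mB).
move=> w /=; rewrite normrM /cutoff indicE; case: (boolP (_ \in _)) => [|_].
  rewrite inE/= normr1 mul1r => Yn; apply: le_trans (bdv ka (DY w)) _.
  by rewrite ler_wpM2l// /weight lerXn2r ?nnegrE ?addr_ge0// lerD2l.
by rewrite normr0 mul0r mulr_ge0// exprn_ge0// addr_ge0.
Qed.

Lemma same_mean_step n (X1 Z1 : 'I_d -> Om -> R) (X2 Z2 : 'I_d -> 'I_d -> Om -> R)
    (X3 Z3 : 'I_d -> 'I_d -> 'I_d -> Om -> R) :
  (forall i, is_condexp P (sigma_of Y) (X1 i) (Z1 i)) ->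
  (forall i j, is_condexp P (sigma_of Y) (X2 i j) (Z2 i j)) ->
  (forall i j k, is_condexp P (sigma_of Y) (X3 i j k) (Z3 i j k)) ->
  same_mean P
    (fun w => cutoff n (Y w) * moment_step (X1 ^~ w) (fun i j => X2 i j w)
                                  (fun i j k => X3 i j k w) (Y w))
    (fun w => cutoff n (Y w) * moment_step (Z1 ^~ w) (fun i j => Z2 i j w)
                                  (fun i j k => Z3 i j k w) (Y w)).
Proof.
move=> H1 H2 H3.
have ord i j k : [/\ (2 * 0 + mdeg (d1 i) <= 4)%N, (2 * 0 + mdeg (d2 i j) <= 4)%N,
    (2 * 0 + mdeg (d3 i j k) <= 4)%N, (2 * 1 + mdeg m0 <= 4)%N
    & (2 * 1 + mdeg (d1 i) <= 4)%N].
  by rewrite !mdeg_mincr mdeg_mindex0.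
under eq_fun do rewrite moment_stepZ.
under [X in same_mean _ _ X]eq_fun do rewrite moment_stepZ.
apply: same_meanD; first apply: same_meanD; first apply: same_meanD.
- apply: same_mean_sum => i; apply: same_mean_cutoff => //.
  by have [] := ord i i i.
- apply: same_meanZ; apply: same_mean_sum => i; apply: same_mean_sum => j.
  by apply: same_mean_cutoff => //; have [] := ord i j i.
- apply: same_meanZ; apply: same_mean_sum => i; apply: same_mean_sum => j.
  apply: same_mean_sum => k.
  by apply: same_mean_cutoff => //; have [] := ord i j k.
- apply: same_meanZ; apply: same_meanD.
    (* the term without increment is the case of the constant 1 *)
    have c1 : is_condexp P (sigma_of Y) (fun=> 1) (fun=> 1).
      split; try exact: rv_cst; last by [].
      move=> B mB; have [B1|B1] := pselect (B 1).
        exists setT; first exact: (@measurableT _ (borel_space R d)).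
        by apply/seteqP; split.
      exists set0; first exact: (@measurable0 _ (borel_space R d)).
      by apply/seteqP; split.
    have := same_mean_cutoff n (k := 1) (a := m0) _ c1.
    rewrite mdeg_mindex0 => /(_ isT).
    have -> // : (fun w => cutoff n (Y w) * dv 1 m0 t (Y w) * 1) =
      (fun w => cutoff n (Y w) * dv 1 m0 t (Y w)).
    by apply/funext => w; rewrite mulr1.
  apply: same_mean_sum => i; apply: same_mean_cutoff => //.
  by have [] := ord i i i.
Qed.

End OneStep.

(** * Cancellation by the backward equation *)

Section OneStepBound.
Context (R : realType) (d l : nat).
Variables (mu : 'cV[R]_d -> 'cV[R]_d) (sigma : 'cV[R]_d -> 'M[R]_(d, l)).
Variable dv : nat -> multi_index d -> R -> 'cV[R]_d -> R.
Variables (t h : R).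
Hypothesis h0 : 0 <= h.
Local Notation m0 := (mindex0 d).
Local Notation d1 i := (mincr m0 i).
Local Notation d2 i j := (mincr (mincr m0 i) j).
Local Notation d3 i j k := (mincr (mincr (mincr m0 i) j) k).

Lemma mincrC (a : multi_index d) i j : mincr (mincr a i) j = mincr (mincr a j) i.
Proof. by apply/ffunP => k; rewrite !ffunE addnAC. Qed.

Lemma generatorE y : generator mu sigma dv t y =
  \sum_i dv 0 (d1 i) t y * mu y i 0
  + 2^-1 * (\sum_i \sum_j dv 0 (d2 i j) t y * diffusion_mx sigma y i j).
Proof.
rewrite /generator addrC; congr (_ + _ * _).
  by rewrite mxE; apply: eq_bigr => i _; rewrite !mxE mulrC.
rewrite /mxtrace; apply: eq_bigr => i _; rewrite mxE; apply: eq_bigr => j _.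
by rewrite [hessian _ _ _ _ _]mxE mincrC mulrC.
Qed.

(** The equation removes the terms that are exactly of order h; each of the
    others contains h^2 or one of the local errors F, G, J. *)
Lemma moment_step_split (y F : 'cV[R]_d) (G : 'M[R]_d) (J : 'I_d -> 'I_d -> 'I_d -> R) :
  dv 1 m0 t y + generator mu sigma dv t y = 0 ->
  moment_step dv t h (fun i => (h *: mu y + F) i 0)
    (fun i j => (h *: diffusion_mx sigma y + G) i j) J y =
  \sum_i dv 0 (d1 i) t y * F i 0
  + 2^-1 * (\sum_i \sum_j dv 0 (d2 i j) t y * G i j)
  + 6^-1 * (\sum_i \sum_j \sum_k dv 0 (d3 i j k) t y * J i j k)
  + (h ^+ 2 * (\sum_i dv 1 (d1 i) t y * mu y i 0)
     + h * (\sum_i dv 1 (d1 i) t y * F i 0)).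
Proof.
rewrite generatorE => pde; rewrite /moment_step.
have e1 k : \sum_i dv k (d1 i) t y * (h *: mu y + F) i 0 =
    h * (\sum_i dv k (d1 i) t y * mu y i 0) + \sum_i dv k (d1 i) t y * F i 0.
  rewrite mulr_sumr -big_split/=; apply: eq_bigr => i _.
  by rewrite !mxE; ring.
have e2 : \sum_i \sum_j dv 0 (d2 i j) t y * (h *: diffusion_mx sigma y + G) i j =
    h * (\sum_i \sum_j dv 0 (d2 i j) t y * diffusion_mx sigma y i j)
    + \sum_i \sum_j dv 0 (d2 i j) t y * G i j.
  rewrite mulr_sumr -big_split/=; apply: eq_bigr => i _.
  rewrite mulr_sumr -big_split/=; apply: eq_bigr => j _.
  rewrite [(_ + G) i j]mxE [X in _ * (X + _)]mxE; ring.
rewrite !e1 e2.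
set S1 := \sum_i dv 0 _ t y * mu y i 0 in pde *.
set S2 := \sum_i \sum_j dv 0 _ t y * diffusion_mx sigma y i j in pde *.
have -> : dv 1 m0 t y = - (S1 + 2^-1 * S2) by apply/eqP; rewrite -addr_eq0 pde.
by ring.
Qed.

Lemma norm_sum_le n (x f : 'I_n -> R) c b : 0 <= c -> 0 <= b ->
  (forall i, `|x i| <= c) -> (forall i, `|f i| <= b) ->
  `|\sum_i x i * f i| <= c * (n%:R * b).
Proof.
move=> c0 b0 xc fb; apply: le_trans (ler_norm_sum _ _ _) _.
have -> : c * (n%:R * b) = \sum_(i < n) c * b.
  by rewrite sumr_const card_ord -[RHS]mulr_natl mulrCA.
by apply: ler_sum => i _; rewrite normrM ler_pM.
Qed.

Lemma moment_step_bound (y F : 'cV[R]_d) (G : 'M[R]_d)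
    (J : 'I_d -> 'I_d -> 'I_d -> R) (c b : R) :
  dv 1 m0 t y + generator mu sigma dv t y = 0 -> 0 <= b ->
  (forall k a, (2 * k + mdeg a <= 4)%N -> `|dv k a t y| <= c) ->
  (forall i, `|mu y i 0| <= b) ->
  `|moment_step dv t h (fun i => (h *: mu y + F) i 0)
    (fun i j => (h *: diffusion_mx sigma y + G) i j) J y| <=
  c * (((1 + h) * d%:R) * enorm F + (d%:R * d%:R) * enorm G
      + (\sum_i \sum_j \sum_k `|J i j k|) + h ^+ 2 * d%:R * b).
Proof.
move=> pde b0 dvc mub; rewrite moment_step_split//.
have c0 : 0 <= c.
  by apply: le_trans (normr_ge0 _) (dvc 0 m0 _); rewrite mdeg_mindex0.
have ord i j k : [/\ (2 * 0 + mdeg (d1 i) <= 4)%N, (2 * 0 + mdeg (d2 i j) <= 4)%N,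
    (2 * 0 + mdeg (d3 i j k) <= 4)%N & (2 * 1 + mdeg (d1 i) <= 4)%N].
  by rewrite !mdeg_mincr mdeg_mindex0.
have B1 k : (k <= 1)%N -> `|\sum_i dv k (d1 i) t y * F i 0| <= c * (d%:R * enorm F).
  move=> k1; apply: norm_sum_le => // [|i|i]; first exact: enorm_ge0.
    by have [? _ _ ?] := ord i i i; case: k k1 => [|[|k]] // _; exact: dvc.
  exact: coord_le_enorm.
have B2 : `|\sum_i \sum_j dv 0 (d2 i j) t y * G i j| <= c * (d%:R * d%:R * enorm G).
  have -> : c * (d%:R * d%:R * enorm G) = 1 * (d%:R * (c * (d%:R * enorm G))) by ring.
  rewrite (eq_bigr (fun i => 1 * \sum_j dv 0 (d2 i j) t y * G i j)); last first.
    by move=> i _; rewrite mul1r.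
  apply: norm_sum_le => // [|i|i]; rewrite ?normr1//.
    by rewrite !mulr_ge0// enorm_ge0.
  apply: norm_sum_le => // [|j|j]; first exact: enorm_ge0.
    by have [_ ? _ _] := ord i j i; exact: dvc.
  exact: coord_le_enorm.
have B3 : `|\sum_i \sum_j \sum_k dv 0 (d3 i j k) t y * J i j k| <=
    c * (\sum_i \sum_j \sum_k `|J i j k|).
  rewrite mulr_sumr; apply: le_trans (ler_norm_sum _ _ _) _; apply: ler_sum => i _.
  rewrite mulr_sumr; apply: le_trans (ler_norm_sum _ _ _) _; apply: ler_sum => j _.
  rewrite mulr_sumr; apply: le_trans (ler_norm_sum _ _ _) _; apply: ler_sum => k _.
  by rewrite normrM ler_wpM2r// dvc//; have [] := ord i j k.
have B4 : `|\sum_i dv 1 (d1 i) t y * mu y i 0| <= c * (d%:R * b).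
  by apply: norm_sum_le => // i; have [_ _ _ ?] := ord i i i; exact: dvc.
have half : (2^-1 : R) <= 1 by rewrite invf_le1// ler1n.
have sixth : (6^-1 : R) <= 1 by rewrite invf_le1// ler1n.
have -> : c * ((1 + h) * d%:R * enorm F + d%:R * d%:R * enorm G
      + (\sum_i \sum_j \sum_k `|J i j k|) + h ^+ 2 * d%:R * b) =
  c * (d%:R * enorm F) + 1 * (c * (d%:R * d%:R * enorm G))
  + 1 * (c * (\sum_i \sum_j \sum_k `|J i j k|)) +
  (h ^+ 2 * (c * (d%:R * b)) + h * (c * (d%:R * enorm F))) by ring.
apply: le_trans (ler_normD _ _) _; apply: lerD; last first.
  apply: le_trans (ler_normD _ _) _; apply: lerD.
    by rewrite normrM normrX ger0_norm// ler_wpM2l// exprn_ge0.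
  by rewrite normrM ger0_norm// ler_wpM2l// B1.
apply: le_trans (ler_normD _ _) _; apply: lerD; last first.
  by rewrite normrM ger0_norm// ler_pM.
apply: le_trans (ler_normD _ _) _; apply: lerD; first exact: B1.
by rewrite normrM ger0_norm// ler_pM.
Qed.

End OneStepBound.

(** * The error of one step *)

Section LocalError.
Context (R : realType) (disp : measure_display) (Om : measurableType disp).
Variables (P : probability Om R) (d l : nat) (D : set 'cV[R]_d).
Hypothesis bD : borel D.
Variables (mu : 'cV[R]_d -> 'cV[R]_d) (sigma : 'cV[R]_d -> 'M[R]_(d, l)).
Hypothesis mu_borel : forall i, borel_on D (fun y => mu y i 0).
Hypothesis sigma_borel : forall i j, borel_on D (fun y => sigma y i j).
Variables (Cmu : R) (mmu : nat).
Hypothesis mu_growth : forall y i, D y -> `|mu y i 0| <= Cmu * weight mmu y.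
Variable dv : nat -> multi_index d -> R -> 'cV[R]_d -> R.
Variables (t h hmax : R) (C K : R) (m : nat).
Hypotheses (h_gt0 : 0 < h) (h_le : h <= hmax) (C_ge0 : 0 <= C) (K_ge0 : 0 <= K) (Cmu_ge0 : 0 <= Cmu).
Hypothesis dv_borel : forall k a, (2 * k + mdeg a <= 4)%N -> borel_on D (dv k a t).
Hypothesis bdv : forall k a, (2 * k + mdeg a <= 4)%N -> forall y, D y ->
  `|dv k a t y| <= C * weight m y.
Local Notation m0 := (mindex0 d).
Hypothesis pde : forall y, D y -> dv 1 m0 t y + generator mu sigma dv t y = 0.
Variables vs vt : 'cV[R]_d -> R.
Hypotheses (vs_borel : borel_on D vs) (vt_borel : borel_on D vt).
Hypothesis vs_growth : forall y, D y -> `|vs y| <= C * weight m y.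
Hypothesis vt_growth : forall y, D y -> `|vt y| <= C * weight m y.
Hypothesis taylor : forall y y', D y -> D y' ->
  `|vs y' - vt y - taylor_step dv t h (y' - y) y|
  <= K * (weight m y * weight m y') * (`|y' - y| ^+ 4 + h * `|y' - y| ^+ 2 + h ^+ 2).

Variables (Y Y' : Om -> 'cV[R]_d).
Hypotheses (mY : random_vector Y) (mY' : random_vector Y').
Hypotheses (DY : forall w, D (Y w)) (DY' : forall w, D (Y' w)).
Variables (F : 'cV[R]_d -> 'cV[R]_d) (G : 'cV[R]_d -> 'M[R]_d)
  (J : multi_index d -> 'cV[R]_d -> R).
Let dY w := Y' w - Y w.
Let cond := is_condexp P (sigma_of Y).
Hypothesis cond1 : forall i, cond (fun w => dY w i 0)
  (fun w => (h *: mu (Y w) + F (Y w)) i 0).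
Hypothesis cond2 : forall i j, cond (fun w => (dY w *m (dY w)^T) i j)
  (fun w => (h *: diffusion_mx sigma (Y w) + G (Y w)) i j).
Hypothesis cond3 : forall a, mdeg a = 3%N -> cond (fun w => mpow (dY w) a)
  (fun w => J a (Y w)).
Variables (p C1 : R).
Hypotheses (p_gt1 : 1 < p) (C1_ge0 : 0 <= C1).
Hypothesis F_small :
  ('N[P]_(p%:E)[(fun w => (enorm (F (Y w)))%:E)] <= (C1 * h ^+ 2)%:E)%E.
Hypothesis G_small :
  ('N[P]_(p%:E)[(fun w => (enorm (G (Y w)))%:E)] <= (C1 * h ^+ 2)%:E)%E.
Hypothesis J_small : forall a, mdeg a = 3%N ->
  ('N[P]_(p%:E)[(fun w => (J a (Y w))%:E)] <= (C1 * h ^+ 2)%:E)%E.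
Variables (M : nat -> R) (L4 L8 : R).
Hypothesis weightY : forall n, mean_le P (fun w => weight n (Y w)) (M n).
Hypothesis weightY' : forall n, mean_le P (fun w => weight n (Y' w)) (M n).
Hypothesis incr4 : mean_le P (fun w => enorm (dY w) ^+ 4) (L4 * h ^+ 2).
Hypothesis incr8 : mean_le P (fun w => enorm (dY w) ^+ 8) (L8 * h ^+ 4).

Local Notation rv f := (P.-integrable setT (EFin \o f)).
Local Notation d3 i j k := (mincr (mincr (mincr m0 i) j) k).
Let W w := weight m (Y w).
Let W' w := weight m (Y' w).

Lemma mpow_mincr (z : 'cV[R]_d) a i : mpow z (mincr a i) = mpow z a * z i 0.
Proof.
rewrite /mpow; under eq_bigr do rewrite ffunE exprD.
rewrite big_split/=; congr (_ * _).
rewrite (bigD1 i)//= eqxx expr1 big1 ?mulr1// => j /negPf ->.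
by rewrite expr0.
Qed.

Lemma mpow3 (z : 'cV[R]_d) i j k : mpow z (d3 i j k) = z i 0 * z j 0 * z k 0.
Proof.
rewrite !mpow_mincr /mpow big1 ?mul1r// => n _.
by rewrite ffunE expr0.
Qed.

Lemma mdeg_d3 i j k : mdeg (d3 i j k) = 3%N.
Proof. by rewrite !mdeg_mincr mdeg_mindex0. Qed.

Lemma cond_measurable X Z : cond X Z -> measurable_fun setT Z.
Proof. by move=> [_ _ mZ _] _ B mB; rewrite setTI; exact/mY/mZ. Qed.

Let mcomp g : borel_on D g -> measurable_fun setT (fun w => g (Y w)).
Proof. by move=> bg; exact: (random_vector_comp mY bg DY). Qed.

Lemma F_measurable : measurable_fun setT (fun w => enorm (F (Y w))).
Proof.
apply: measurable_enorm => i j; rewrite [j]ord1.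
have -> : (fun w => F (Y w) i 0) =
  (fun w => (h *: mu (Y w) + F (Y w)) i 0 - h * mu (Y w) i 0).
  by apply/funext => w; rewrite !mxE addrAC subrr add0r.
apply: measurable_funB; first exact: (cond_measurable (cond1 i)).
by apply: measurable_funM => //; exact: (mcomp (mu_borel i)).
Qed.

Lemma G_measurable : measurable_fun setT (fun w => enorm (G (Y w))).
Proof.
apply: measurable_enorm => i j.
have -> : (fun w => G (Y w) i j) =
  (fun w => (h *: diffusion_mx sigma (Y w) + G (Y w)) i j
            - h * \sum_k sigma (Y w) i k * sigma (Y w) j k).
  apply/funext => w.
  have -> : \sum_k sigma (Y w) i k * sigma (Y w) j k = diffusion_mx sigma (Y w) i j.
    by rewrite [RHS]mxE; apply: eq_bigr => k _; rewrite mxE.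
  by rewrite [(_ + G _) i j]mxE [X in _ = (X + _) - _]mxE addrAC subrr add0r.
apply: measurable_funB; first exact: (cond_measurable (cond2 i j)).
apply: measurable_funM => //; apply: measurable_sum => k.
by apply: measurable_funM; exact: (mcomp (sigma_borel _ _)).
Qed.

Lemma J_measurable a : mdeg a = 3%N -> measurable_fun setT (fun w => `|J a (Y w)|).
Proof. by move=> a3; exact/measurableT_comp/(cond_measurable (cond3 a3)). Qed.

Lemma dY_measurable : measurable_fun setT (fun w => enorm (dY w)).
Proof.
apply: measurable_enorm => i j; rewrite [j]ord1.
have -> : (fun w => dY w i 0) = (fun w => Y' w i 0 - Y w i 0).
  by apply/funext => w; rewrite /dY !mxE.
by apply: measurable_funB; exact: random_vector_coord.
Qed.

Let W_measurable : measurable_fun setT W. Proof. exact: measurable_weight. Qed.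
Let W'_measurable : measurable_fun setT W'. Proof. exact: measurable_weight. Qed.

(** q is the exponent conjugate to p; as W >= 1, the weight of index mq dominates
    the q-th power of W. *)
Let q := (1 - p^-1)^-1.
Let mq := (m * (Num.bound q).+1)%N.
Definition smallness_const := C1 `^ p + M mq.

Let p_gt0 : 0 < p. Proof. exact: lt_trans p_gt1. Qed.
Let iq_gt0 : 0 < 1 - p^-1. Proof. by rewrite subr_gt0 invf_lt1. Qed.

Lemma W_power : mean_le P (fun w => W w `^ q) (M mq).
Proof.
apply: mean_le_dom (weightY mq) _ _.
  exact: (measurableT_comp (measurable_powR q)).
move=> w; rewrite powR_ge0/= /mq.
have -> : weight (m * (Num.bound q).+1) (Y w) = W w `^ (Num.bound q).+1%:R.
  by rewrite powR_mulrn ?weight_ge0// /W /weight exprM.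
apply: ler_powR; first exact: weight_ge1.
have q0 : 0 <= q by rewrite invr_ge0 ltW.
rewrite (le_trans (ltW (archi_boundP q0)))// ler_nat//.
Qed.

Lemma small_mean (g : Om -> R) : measurable_fun setT g -> (forall w, 0 <= g w) ->
  ('N[P]_(p%:E)[(fun w => (g w)%:E)] <= (C1 * h ^+ 2)%:E)%E ->
  mean_le P (fun w => W w * g w) (h ^+ 2 * smallness_const).
Proof.
move=> mg g0 gs.
have h2 : 0 < h ^+ 2 by rewrite exprn_gt0.
have gp := Lnorm_moment p_gt0 (mulr_ge0 C1_ge0 (ltW h2)) mg g0 gs.
apply: (mean_le_young p_gt1 _ h2 mg W_measurable g0 _ C1_ge0 gp W_power).
  by rewrite /q invrK addrC subrK.
by move=> w; exact: weight_ge0.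
Qed.

(** A bound, uniform in the cutoff, for the conditional mean of a step once the
    terms of order h have cancelled. *)
Definition bias w : R := C * W w * (((1 + hmax) * d%:R) * enorm (F (Y w))
  + (d%:R * d%:R) * enorm (G (Y w))
  + (\sum_i \sum_j \sum_k `|J (d3 i j k) (Y w)|)
  + h ^+ 2 * d%:R * (Cmu * weight mmu (Y w))).

Definition bias_const : R := C * ((1 + hmax) * d%:R * smallness_const +
   d%:R * d%:R * smallness_const + d%:R * (d%:R * (d%:R * smallness_const))
   + d%:R * Cmu * M (m + mmu)).

Lemma bias_mean : mean_le P bias (h ^+ 2 * bias_const).
Proof.
have d0 : 0 <= d%:R :> R by [].
have h1 : 0 <= (1 + hmax) * d%:R.
  by rewrite mulr_ge0// addr_ge0// (le_trans (ltW h_gt0)).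
have c0 : 0 <= h ^+ 2 * d%:R * Cmu by rewrite !mulr_ge0 ?(ltW h_gt0).
have HF := mean_leZ h1 (small_mean F_measurable (fun w => enorm_ge0 _) F_small).
have HG := mean_leZ (mulr_ge0 d0 d0) (small_mean G_measurable (fun w => enorm_ge0 _) G_small).
have HJ i j k : mean_le P (fun w => W w * `|J (d3 i j k) (Y w)|) (h ^+ 2 * smallness_const).
  apply: small_mean => //; first exact/J_measurable/mdeg_d3.
  by rewrite (Lnorm_abse P (fun w => (J (d3 i j k) (Y w))%:E)); exact/J_small/mdeg_d3.
have HJ3 := mean_le_sum (fun i => mean_le_sum (fun j => mean_le_sum (fun k => HJ i j k))).
have HM := mean_leZ c0 (weightY (m + mmu)).
have H := mean_leZ C_ge0 (mean_leD (mean_leD (mean_leD HF HG) HJ3) HM).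
have -> : h ^+ 2 * bias_const = C * ((1 + hmax) * d%:R * (h ^+ 2 * smallness_const) +
     d%:R * d%:R * (h ^+ 2 * smallness_const) +
     d%:R * (d%:R * (d%:R * (h ^+ 2 * smallness_const))) +
     h ^+ 2 * d%:R * Cmu * M (m + mmu)).
  by rewrite /bias_const; ring.
congr mean_le: H; apply/funext => w; rewrite /bias weightD -/(W w).
rewrite -!mulrA; congr (C * _).
under eq_bigr => i _ do under eq_bigr => j _ do rewrite -mulr_sumr.
under eq_bigr => i _ do rewrite -mulr_sumr.
rewrite -mulr_sumr; ring.
Qed.

Definition remainder w : R :=
  K * (W w * W' w) * (enorm (dY w) ^+ 4 + h * enorm (dY w) ^+ 2 + h ^+ 2).

Definition remainder_const : R :=
  K * ((M (m * 4) + M (m * 4) + L8) + (M (m * 4) + M (m * 4) + L4)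
       + (M (m * 2) + M (m * 2))).

Let weightX n (Z : Om -> 'cV[R]_d) : (fun w => weight m (Z w) ^+ n) =
  (fun w => weight (m * n) (Z w)).
Proof. by apply/funext => w; rewrite /weight exprM. Qed.

(** From f g <= f^2 + g^2, with the powers of h distributed so that both squares
    have means of order h^2: for W W' |z|^4 the factors are h W W' and |z|^4 / h,
    for h W W' |z|^2 they are h W W' and |z|^2. *)
Lemma remainder_mean : mean_le P remainder (h ^+ 2 * remainder_const).
Proof.
have h0 := ltW h_gt0.
have hn0 : h != 0 by rewrite lt0r_neq0.
have mWW : measurable_fun setT (fun w => W w * W' w) by exact: measurable_funM.
have WW0 w : 0 <= W w * W' w by rewrite mulr_ge0// weight_ge0.
have WW2 : mean_le P (fun w => W w * W' w) (M (m * 2) + M (m * 2)).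
  apply: mean_le_sqM => //; try by move=> w; exact: weight_ge0.
    by rewrite weightX.
  by rewrite weightX.
have WW4 : mean_le P (fun w => (W w * W' w) ^+ 2) (M (m * 4) + M (m * 4)).
  under eq_fun do rewrite exprMn.
  apply: mean_le_sqM => //; try exact: measurable_funX;
    try by move=> w; rewrite exprn_ge0// weight_ge0.
  - by under eq_fun do rewrite -exprM; rewrite weightX.
  - by under eq_fun do rewrite -exprM; rewrite weightX.
have hWW : mean_le P (fun w => (h * (W w * W' w)) ^+ 2)
    (h ^+ 2 * (M (m * 4) + M (m * 4))).
  under eq_fun do rewrite exprMn.
  by apply: mean_leZ => //; exact: exprn_ge0.
have R1 : mean_le P (fun w => (h * (W w * W' w)) * (h^-1 * enorm (dY w) ^+ 4))
    (h ^+ 2 * (M (m * 4) + M (m * 4)) + h ^+ 2 * L8).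
  apply: mean_le_sqM => //.
  - have -> : h ^+ 2 * L8 = h^-1 ^+ 2 * (L8 * h ^+ 4) by field.
    under eq_fun do rewrite exprMn -exprM.
    by apply: mean_leZ => //; rewrite exprn_ge0// invr_ge0.
  - exact: measurable_funM.
  - by apply: measurable_funM => //; exact/measurable_funX/dY_measurable.
  - by move=> w; rewrite mulr_ge0.
  - by move=> w; rewrite mulr_ge0 ?invr_ge0// exprn_ge0// enorm_ge0.
have R2 : mean_le P (fun w => (h * (W w * W' w)) * enorm (dY w) ^+ 2)
    (h ^+ 2 * (M (m * 4) + M (m * 4)) + h ^+ 2 * L4).
  apply: mean_le_sqM => //.
  - by under eq_fun do rewrite -exprM; rewrite [_ * L4]mulrC.
  - exact: measurable_funM.
  - exact/measurable_funX/dY_measurable.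
  - by move=> w; rewrite mulr_ge0.
  - by move=> w; rewrite exprn_ge0// enorm_ge0.
have H := mean_leZ K_ge0 (mean_leD (mean_leD R1 R2) (mean_leZ (exprn_ge0 2 h0) WW2)).
have -> : h ^+ 2 * remainder_const =
   K * (h ^+ 2 * (M (m * 4) + M (m * 4)) + h ^+ 2 * L8 +
    (h ^+ 2 * (M (m * 4) + M (m * 4)) + h ^+ 2 * L4) +
    h ^+ 2 * (M (m * 2) + M (m * 2))) by rewrite /remainder_const; ring.
congr mean_le: H; apply/funext => w; rewrite /remainder; field.
exact: hn0.
Qed.

Lemma vs_rv : rv (fun w => vs (Y' w)).
Proof.
apply: (rv_le (g := fun w => C * W' w)).
- exact: (random_vector_comp mY' vs_borel DY').
- by move=> w; exact: vs_growth.
- exact: mean_le_rv (mean_leZ C_ge0 (weightY' m)).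
Qed.

Lemma vt_rv : rv (fun w => vt (Y w)).
Proof.
apply: (rv_le (g := fun w => C * W w)).
- exact: (random_vector_comp mY vt_borel DY).
- by move=> w; exact: vt_growth.
- exact: mean_le_rv (mean_leZ C_ge0 (weightY m)).
Qed.

Let step w := moment_step dv t h (fun i => (h *: mu (Y w) + F (Y w)) i 0)
    (fun i j => (h *: diffusion_mx sigma (Y w) + G (Y w)) i j)
    (fun i j k => J (d3 i j k) (Y w)) (Y w).

Lemma step_le_bias w : `|step w| <= bias w.
Proof.
have CW0 : 0 <= C * W w by rewrite mulr_ge0// weight_ge0.
apply: (@le_trans _ _ (C * W w * (((1 + h) * d%:R) * enorm (F (Y w))
  + (d%:R * d%:R) * enorm (G (Y w))
  + (\sum_i \sum_j \sum_k `|J (d3 i j k) (Y w)|)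
  + h ^+ 2 * d%:R * (Cmu * weight mmu (Y w))))).
  apply: moment_step_bound => //.
  - exact: ltW.
  - exact: pde.
  - by rewrite mulr_ge0// weight_ge0.
  - by move=> k a ka; exact: bdv.
  - by move=> i; exact: mu_growth.
rewrite /bias ler_wpM2l// !lerD2r ler_wpM2r ?enorm_ge0// ler_wpM2r//.
by rewrite lerD2l.
Qed.

Lemma local_error_cutoff n :
  `|\int[P]_w (cutoff n (Y w) * (vs (Y' w) - vt (Y w)))|
  <= h ^+ 2 * (bias_const + remainder_const).
Proof.
pose tay w := taylor_step dv t h (dY w) (Y w).
have [rt rs e] : same_mean P (fun w => cutoff n (Y w) * tay w)
    (fun w => cutoff n (Y w) * step w).
  have -> : (fun w => cutoff n (Y w) * tay w) = (fun w => cutoff n (Y w) *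
    moment_step dv t h (fun i => dY w i 0) (fun i j => dY w i 0 * dY w j 0)
      (fun i j k => dY w i 0 * dY w j 0 * dY w k 0) (Y w)).
    by apply/funext => w; rewrite /tay taylor_stepE.
  have := @same_mean_step _ _ _ P d D bD Y mY DY dv t h C m dv_borel bdv n.
  move=> S; apply: (S
    (fun i w => dY w i 0) (fun i w => (h *: mu (Y w) + F (Y w)) i 0)
    (fun i j w => dY w i 0 * dY w j 0)
    (fun i j w => (h *: diffusion_mx sigma (Y w) + G (Y w)) i j)
    (fun i j k w => dY w i 0 * dY w j 0 * dY w k 0)
    (fun i j k w => J (d3 i j k) (Y w))).
  - exact: cond1.
  - move=> i j; have := cond2 i j.
    congr is_condexp; apply/funext => w.
    by rewrite mxE big_ord1 !mxE.
  - move=> i j k; have := cond3 (mdeg_d3 i j k).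
    by congr is_condexp; apply/funext => w; rewrite mpow3.
have mc : measurable_fun setT (fun w => cutoff n (Y w)) by exact: (mcomp (cutoff_borel bD n)).
have c01 w : `|cutoff n (Y w)| <= 1.
  by have /andP[c0 c1] := cutoff01 n (Y w); rewrite ger0_norm.
have rX : rv (fun w => cutoff n (Y w) * (vs (Y' w) - vt (Y w))).
  apply: (rv_boundedM (c := 1)) => //.
  exact: rvB vs_rv vt_rv.
have -> : \int[P]_w (cutoff n (Y w) * (vs (Y' w) - vt (Y w))) =
   \int[P]_w (cutoff n (Y w) * step w) +
   \int[P]_w (cutoff n (Y w) * (vs (Y' w) - vt (Y w)) - cutoff n (Y w) * tay w).
  by rewrite RintegralB// -e addrC subrK.
rewrite mulrDr; apply: le_trans (ler_normD _ _) _; apply: lerD.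
  apply: le_trans (mean_leP bias_mean); apply: mean_norm_le.
  - exact: rv_measurable rs.
  - move=> w; rewrite normrM -[leRHS]mul1r ler_pM//; exact: step_le_bias.
  - exact: mean_le_rv bias_mean.
apply: le_trans (mean_leP remainder_mean); apply: mean_norm_le.
- exact: rv_measurable (rvB rX rt).
- move=> w; rewrite -mulrBr normrM -[leRHS]mul1r ler_pM//.
  apply: le_trans (taylor (DY w) (DY' w)) _.
  have zle : `|dY w| <= enorm (dY w) by exact: norm_le_enorm.
  rewrite /remainder ler_wpM2l ?mulr_ge0 ?weight_ge0// lerD2r lerD//.
    by rewrite lerXn2r ?nnegrE ?enorm_ge0.
  by rewrite ler_wpM2l ?(ltW h_gt0)// lerXn2r ?nnegrE ?enorm_ge0.
- exact: mean_le_rv remainder_mean.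
Qed.

(** The bound on the event |Y| <= n does not depend on n, and dominated
    convergence removes the restriction. *)
Lemma local_error :
  `|\int[P]_w vs (Y' w) - \int[P]_w vt (Y w)|
  <= h ^+ 2 * (bias_const + remainder_const).
Proof.
rewrite -RintegralB//; [|exact: vs_rv|exact: vt_rv].
have rX := rvB vs_rv vt_rv.
set X := fun w => vs (Y' w) - vt (Y w) in rX.
have cX : \int[P]_w (cutoff n (Y w) * X w) @[n --> \oo] --> \int[P]_w X w.
  have mX := rv_measurable rX.
  have [|||||_ _ H] := @dominated_convergence _ _ _ P setT measurableT
    (fun n w => (cutoff n (Y w) * X w)%:E) (fun w => (X w)%:E)
    (fun w => (`|X w|)%:E).
  - move=> n; apply/measurable_EFinP; apply: measurable_funM => //.
    exact: (mcomp (cutoff_borel bD n)).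
  - exact/measurable_EFinP.
  - apply/aeW => w _; apply: cvg_near_cst; near=> n.
    rewrite /cutoff indicE mem_set ?mul1r//=.
    by near: n; exact: nbhs_infty_ger.
  - exact: integrable_norm.
  - apply/aeW => w n _; rewrite lee_fin normrM ler_piMl//.
    by have /andP[c0 c1] := cutoff01 n (Y w); rewrite ger0_norm.
  apply: fine_cvg; rewrite fineK; last exact: integrable_fin_num.
  exact: H.
apply: (ler_cvg_to (cvg_norm cX) (@cvg_cst _ _ _ _ _)).
by apply: nearW => n; exact: local_error_cutoff.
Unshelve. all: by end_near. Qed.
End LocalError.

(** * The law of the diffusion at the terminal time *)

Section Laws.
Variable R : realType.

(** The positive and the negative parts are transported one by one to the line,
    where the two image measures coincide. *)
Lemma integral_same_distribution (disp1 disp2 : measure_display)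
  (Om1 : measurableType disp1) (Om2 : measurableType disp2)
  (P1 : probability Om1 R) (P2 : probability Om2 R)
  (Z1 : Om1 -> R) (Z2 : Om2 -> R) :
  measurable_fun setT Z1 -> measurable_fun setT Z2 ->
  (forall B : set R, measurable B -> P1 (Z1 @^-1` B) = P2 (Z2 @^-1` B)) ->
  (\int[P1]_w (Z1 w)%:E = \int[P2]_w (Z2 w)%:E)%E.
Proof.
move=> mZ1 mZ2 law.
pose mf1 := isMeasurableFun.Build _ _ _ _ Z1 mZ1.
pose mf2 := isMeasurableFun.Build _ _ _ _ Z2 mZ2.
pose X1 : {mfun Om1 >-> R} := HB.pack Z1 mf1.
pose X2 : {mfun Om2 >-> R} := HB.pack Z2 mf2.
have pushE (g : R -> \bar R) : measurable_fun setT g -> (forall x, 0 <= g x)%E ->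
    (\int[P1]_w g (Z1 w) = \int[P2]_w g (Z2 w))%E.
  move=> mg g0.
  rewrite -[LHS](ge0_integral_distribution (P := P1) X1 mg g0).
  rewrite -[RHS](ge0_integral_distribution (P := P2) X2 mg g0).
  by apply: eq_measure_integral => A mA _; exact: law.
rewrite integralE [RHS]integralE; congr (_ - _)%E.
  have H := pushE (@EFin R)^\+%E (measurable_funepos (@EFin_measurable R setT)) (@funepos_ge0 _ _ _).
  apply: etrans (etrans _ H) _.
    by apply: eq_integral => w _; rewrite [LHS]funeposE [RHS]funeposE.
  by apply: eq_integral => w _; rewrite [LHS]funeposE [RHS]funeposE.
have H := pushE (@EFin R)^\-%E (measurable_funeneg (@EFin_measurable R setT)) (@funeneg_ge0 _ _ _).
apply: etrans (etrans _ H) _.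
  by apply: eq_integral => w _; rewrite [LHS]funenegE [RHS]funenegE.
by apply: eq_integral => w _; rewrite [LHS]funenegE [RHS]funenegE.
Qed.

Variables (d l : nat) (T : R) (D : set 'cV[R]_d).
Variables (mu : 'cV[R]_d -> 'cV[R]_d) (sigma : 'cV[R]_d -> 'M[R]_(d, l)).
Hypothesis T0 : 0 <= T.
Variable f : 'cV[R]_d -> R.
Hypothesis f_borel : borel_on D f.

(** As the filtration contains the negligible sets, the event that the solution
    leaves the domain, where f is arbitrary, does not spoil measurability. *)
Lemma terminal_measurable (t : R) (y : 'cV[R]_d) (X : sde_system R d l) :
  0 <= t <= T -> weak_solution T D mu sigma t y X ->
  measurable_fun setT (fun w => f (sde_Y X T w)) /\
  forall B : set R, measurable B ->
    sde_prob X ((fun w => f (sde_Y X T w)) @^-1` B) =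
    sde_prob X (sde_Y X T @^-1` (D `&` f @^-1` B)).
Proof.
move=> /andP[t0 tT] [[[Fsig Fmono Fneg _] _] [Xad _] XD _ _].
have TI : `[t, T]%classic T by rewrite /= in_itv/= tT lexx.
have FT := (Fsig T T0).2.
have F0 := (Fsig 0 (lexx 0)).2.
pose E := [set w | ~ D (sde_Y X T w)].
have negE B : (sde_prob X).-negligible (E `&` B).
  apply: (negligibleS _ XD) => w [/= nD _] H; apply: nD; apply: H.
  by rewrite tT lexx.
have mneg B : measurable (E `&` B) by exact/F0/Fneg/negE.
have mA B : measurable B -> measurable (sde_Y X T @^-1` (D `&` f @^-1` B)).
  by move=> mB; apply: FT; apply: Xad => //; exact: f_borel.
have split B : (fun w => f (sde_Y X T w)) @^-1` B =
    sde_Y X T @^-1` (D `&` f @^-1` B) `|` (E `&` (fun w => f (sde_Y X T w)) @^-1` B).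
  apply/seteqP; split => w /=.
    by move=> Bw; have [Dw|Dw] := pselect (D (sde_Y X T w)); [left|right].
  by case => -[].
split=> [_ B mB|B mB].
  by rewrite setTI split; apply: measurableU; [exact: mA|exact: mneg].
rewrite split measureU//; last first.
- by rewrite -subset0 => w [[/= ? _] [? _]].
- exact: mA.
- rewrite [X in (_ + X)%E](_ : _ = 0%E) ?adde0//.
  have [N [mN N0 EN]] := negE ((fun w => f (sde_Y X T w)) @^-1` B).
  by apply: (subset_measure0 _ mN EN N0).
Qed.

Lemma same_law_terminal_mean (t : R) (y y' : 'cV[R]_d) (X X' : sde_system R d l) :
  borel D -> 0 <= t <= T -> weak_solution T D mu sigma t y X ->
  weak_solution T D mu sigma t y' X' -> same_law T t X X' ->
  ('E_(sde_prob X)[(fun w => f (sde_Y X T w))] =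
  'E_(sde_prob X')[(fun w => f (sde_Y X' T w))])%E.
Proof.
move=> bD tT XP X'P law; rewrite unlock.
have [mX eX] := terminal_measurable tT XP.
have [mX' eX'] := terminal_measurable tT X'P.
apply: integral_same_distribution => // B mB.
rewrite eX// eX'//.
have TI : t <= T <= T by have /andP[_ ->] := tT; rewrite lexx.
have := law 1%N (fun=> T) (fun=> D `&` f @^-1` B) (fun=> TI)
  (fun=> f_borel mB).
have E (A : Type) (S : set A) : \bigcap_(k : 'I_1) S = S.
  by apply/seteqP; split => [x H|x Sx i _ //]; exact: (H ord0 I).
by rewrite !E.
Qed.

End Laws.

(** * Growth and measurability of the value function *)

Section PolynomialGrowth.
Variables (R : realType) (d : nat).
Hypothesis d0 : (0 < d)%N.

(** The number d compares the Euclidean norm with the sup norm of the weight. *)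
Lemma poly_weight (c : R) : 0 <= c -> exists m : nat, exists K : R, 0 <= K /\
  forall y : 'cV[R]_d, 1 + enorm y `^ c <= K * weight m y.
Proof.
move=> c0; pose m := Num.bound c; exists m, (1 + d%:R ^+ m); split.
  by rewrite addr_ge0// exprn_ge0.
move=> y; rewrite mulrDl mul1r; apply: lerD; first exact: weight_ge1.
have d1 : 1 <= d%:R :> R by rewrite ler1n.
have y1 : 1 <= 1 + `|y| by rewrite lerDl.
apply: (@le_trans _ _ ((d%:R * (1 + `|y|)) `^ c)).
  apply: ge0_ler_powR; rewrite ?nnegrE ?enorm_ge0 ?mulr_ge0 ?addr_ge0//.
  by apply: le_trans (enorm_le_norm y) _; rewrite ler_wpM2l// lerDr.
apply: (@le_trans _ _ ((d%:R * (1 + `|y|)) `^ m%:R)).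
  apply: ler_powR; last exact/ltW/archi_boundP.
  by rewrite -[leLHS]mul1r ler_pM.
by rewrite powR_mulrn ?mulr_ge0 ?addr_ge0// exprMn.
Qed.

End PolynomialGrowth.

Section ValueFunction.
Variables (R : realType) (d : nat) (T : R) (D O : set 'cV[R]_d) (o : 'cV[R]_d).
Hypotheses (T0 : 0 < T) (bD : borel D).
Variables (u : R -> 'cV[R]_d -> R) (q : nat) (C : R) (m : nat).
Variable dv : nat -> multi_index d -> R -> 'cV[R]_d -> R.
Hypothesis dvP : pderivs T D q u dv.
Hypothesis bdv : forall k a, (2 * k + mdeg a <= q)%N -> forall (t : R) y,
  0 <= t < T -> D y -> `|dv k a t y| <= C * weight m y.
Hypothesis uT : forall y, D y -> u t y @[t --> T^'-] --> u T y.

Lemma dv_borel_space k a (t : R) : (2 * k + mdeg a <= q)%N -> 0 <= t < T ->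
  borel_on D (dv k a t).
Proof.
move=> ka tI; apply/borel_onE => //; apply: within_continuous_measurable => //.
have [_ cdv _ _] := dvP; apply/subspace_continuousP => y Dy.
have := @within_continuous_cvg _ _ _ (within D (nbhs y)) _ _
  (fun p : R * 'cV[R]_d => dv k a p.1 p.2) (fun x => (t, x)) (t, y) (cdv _ _ ka).
apply => //=.
- apply: (@cvg_pair _ _ _ (within D (nbhs y)) (nbhs t) (nbhs y) _ _ _ (fun=> t) id).
    exact: cvg_cst.
  exact: cvg_within.
- by apply: filterS (withinT D (nbhs_filter y)).
Qed.

(** At the terminal time u is the limit of the functions u(r_n, .), with r_n
    increasing to T. *)
Lemma u_borel (s : R) : 0 <= s <= T -> borel_on D (u s).
Proof.
have m0q : (2 * 0 + mdeg (mindex0 d) <= q)%N by rewrite mdeg_mindex0.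
have [dv0 _ _ _] := dvP.
have lt_case r : 0 <= r < T -> borel_on D (u r).
  move=> rI B mB.
  have -> : D `&` u r @^-1` B = D `&` dv 0 (mindex0 d) r @^-1` B.
    by apply/seteqP; split => y /= [Dy]; rewrite dv0.
  exact: dv_borel_space.
move=> /andP[s0]; rewrite le_eqVlt => /predU1P[->|sT]; last by apply: lt_case; rewrite s0.
pose r_ (n : nat) := T - T / n.+1%:R.
have rT n : r_ n < T by rewrite /r_ ltrBlDr ltrDl divr_gt0.
have r0 n : 0 <= r_ n.
  by rewrite /r_ subr_ge0 ler_pdivrMr// ler_peMr ?ler1n// ltW.
have rcv : r_ n @[n --> \oo] --> T.
  rewrite -[X in _ --> X]subr0 /r_; apply: cvgB; first exact: cvg_cst.
  rewrite -[X in _ --> X](mulr0 T); apply: cvgM; first exact: cvg_cst.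
  exact: cvg_harmonic.
apply/borel_onE => //.
apply: (@measurable_fun_cvg _ (borel_space R d) R D (fun n => u (r_ n)) (u T)).
  by move=> n; apply/borel_onE => //; apply: lt_case; rewrite r0 rT.
move=> y Dy; have /cvg_at_leftP := uT Dy; apply.
by split.
Qed.

Lemma u_growth (s : R) y : 0 <= s <= T -> D y -> `|u s y| <= C * weight m y.
Proof.
have m0q : (2 * 0 + mdeg (mindex0 d) <= q)%N by rewrite mdeg_mindex0.
have [dv0 _ _ _] := dvP.
move=> /andP[s0]; rewrite le_eqVlt => /predU1P[->|sT] Dy; last first.
  by rewrite -dv0// ?s0//; apply: bdv => //; rewrite s0.
apply: (ler_cvg_to (cvg_norm (uT Dy)) (@cvg_cst _ _ _ _ _)).
near=> r.
have rI : 0 <= r < T.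
  apply/andP; split; last by near: r; exact: nbhs_left_lt.
  by near: r; exact: nbhs_left_ge.
by rewrite -dv0//; exact: bdv.
Unshelve. all: by end_near. Qed.

End ValueFunction.

Lemma generator_eq (R : realType) (d l : nat) (mu : 'cV[R]_d -> 'cV[R]_d)
    (sigma : 'cV[R]_d -> 'M[R]_(d, l))
    (dv du : nat -> multi_index d -> R -> 'cV[R]_d -> R) t y :
  (forall i, dv 0%N (mincr (mindex0 d) i) t y = du 0%N (mincr (mindex0 d) i) t y) ->
  (forall i j, dv 0%N (mincr (mincr (mindex0 d) i) j) t y =
               du 0%N (mincr (mincr (mindex0 d) i) j) t y) ->
  generator mu sigma dv t y = generator mu sigma du t y.
Proof.
move=> e1 e2; rewrite !generatorE; congr (_ + _ * _).
  by apply: eq_bigr => i _; rewrite e1.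
by apply: eq_bigr => i _; apply: eq_bigr => j _; rewrite e2.
Qed.

Lemma telescope_bound (R : realType) (a : nat -> R) (b : R) N :
  (forall n, (n < N)%N -> `|a n.+1 - a n| <= b) -> `|a N - a 0%N| <= N%:R * b.
Proof.
elim: N => [_|N IH H]; first by rewrite subrr normr0 mul0r.
have -> : a N.+1 - a 0%N = (a N.+1 - a N) + (a N - a 0%N) by rewrite addrA subrK.
rewrite -natr1 addrC [leRHS]mulrDl mul1r (le_trans (ler_normD _ _))// lerD//.
  by apply: IH => n nN; apply: H; exact: ltnW.
exact: H.
Qed.

(** * Weak convergence of order one *)

Theorem theorem4p3p1 (R : realType) (d l : nat) (hd : (0 < d)%N) (hl : (0 < l)%N)
  (D : set 'cV[R]_d) (hD : convex_domain_or_closure D)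
  (T : R) (hT : 0 < T)
  (mu : 'cV[R]_d -> 'cV[R]_d) (sigma : 'cV[R]_d -> 'M[R]_(d, l))
  (hmu_meas : forall i, borel_on D (fun y => mu y i 0))
  (hsigma_meas : forall i j, borel_on D (fun y => sigma y i j))
  (hmu : poly_growth D mu)
  (f : 'cV[R]_d -> R)
  (* the solutions Y^{t,y}: weak existence and uniqueness in law *)
  (X : R -> 'cV[R]_d -> sde_system R d l)
  (hX : forall (t : R) (y : 'cV[R]_d), 0 <= t <= T -> D y -> weak_solution T D mu sigma t y (X t y))
  (huniq : forall (t : R) (y : 'cV[R]_d), 0 <= t <= T -> D y -> forall X1 X2 : sde_system R d l,
     weak_solution T D mu sigma t y X1 -> weak_solution T D mu sigma t y X2 ->
     same_law T t X1 X2)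
  (hf : forall (t : R) (y : 'cV[R]_d), 0 <= t <= T -> D y ->
     (sde_prob (X t y)).-integrable setT
       (fun w => (f (sde_Y (X t y) T w))%:E))
  (hpde : solves_terminal_problem mu sigma T D f (value_function T f X))
  (* the diffusion Y, started from y0 at time 0 *)
  (y0 : 'cV[R]_d) (hy0 : D y0)
  (Y : sde_system R d l) (hY : weak_solution T D mu sigma 0 y0 Y)
  (* the approximating chains, with N steps of length T / N *)
  (S : nat -> nat -> set 'cV[R]_d)
  (hS : forall N n, (0 < N)%N -> (n <= N)%N -> S N n `<=` D)
  (Yh : nat -> chain R d)
  (hYh : forall N, (0 < N)%N -> markov_chain N (S N) (Yh N))
  (hYh0 : forall N w, (0 < N)%N -> ch_Y (Yh N) 0 w = y0)
  (hA1 : assumption_A1 T mu (diffusion_mx sigma) Yh)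
  (hA2 : assumption_A2 T Yh)
  (hu : C_pol T D 4 (value_function T f X)) :
  exists2 hbar : R, 0 < hbar &
  exists2 C : R, 0 < C &
  forall N, (0 < N)%N -> T / N%:R < hbar ->
    (`| 'E_(ch_prob (Yh N))[(fun w => f (ch_Y (Yh N) N w))]
        - 'E_(sde_prob Y)[(fun w => f (sde_Y Y T w))] |
     <= (C * T * (T / N%:R))%:E)%E.
Proof.
have [U [[x0 Ux0] oU cU'] DU] := hD.
have bD := convex_domain_or_closure_borel hD.
have cU := convex_set_segment cU'.
have UD : U `<=` D by case: DU => ->//; exact: subset_closure.
have DclU : D `<=` closure U by case: DU => ->//; exact: subset_closure.
set u := value_function T f X in hpde hu.
have [[du duP pdeu] uTf] := hpde.
have [dv dvP [C0 [c0 [C0_gt0 c0_gt0 dvbound]]]] := hu.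
have [m [Kw [Kw0 weight_le]]] := poly_weight hd (ltW c0_gt0).
pose C := C0 * Kw.
have C_ge0 : 0 <= C by rewrite mulr_ge0// ltW.
have bdv k a : (2 * k + mdeg a <= 4)%N -> forall (t : R) y, 0 <= t < T -> D y ->
    `|dv k a t y| <= C * weight m y.
  move=> ka t y tI Dy; apply: le_trans (dvbound _ _ ka _ _ tI Dy) _.
  by rewrite /C -mulrA ler_wpM2l// ltW.
have [Cm [cm [Cm_gt0 cm_gt0 mubound]]] := hmu.
have [mmu [Kmu [Kmu0 weight_mu_le]]] := poly_weight hd (ltW cm_gt0).
pose Cmu := Cm * Kmu.
have Cmu_ge0 : 0 <= Cmu by rewrite mulr_ge0// ltW.
have mu_growth y i : D y -> `|mu y i 0| <= Cmu * weight mmu y.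
  move=> Dy; apply: le_trans (coord_le_enorm _ _ _) _.
  apply: le_trans (mubound _ Dy) _.
  by rewrite /Cmu -mulrA ler_wpM2l// ltW.
have uT y : D y -> u t y @[t --> T^'-] --> u T y.
  by move=> Dy; have [-> ] := uTf _ Dy.
have uB s : 0 <= s <= T -> borel_on D (u s).
  exact: (u_borel hT bD dvP uT).
have uG s y : 0 <= s <= T -> D y -> `|u s y| <= C * weight m y.
  exact: (u_growth hT dvP bdv uT).
have TT : 0 <= T <= T by rewrite (ltW hT) lexx.
have OT : 0 <= (0 : R) <= T by rewrite lexx (ltW hT).
have f_borel : borel_on D f.
  move=> B mB; have -> : D `&` f @^-1` B = D `&` u T @^-1` B.
    by apply/seteqP; split => y /= [Dy]; have [-> _] := uTf _ Dy.
  exact: uB.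
(* the two families of derivatives of u agree, so the equation holds for dv *)
have pde t y : 0 <= t < T -> D y -> dv 1 (mindex0 d) t y + generator mu sigma dv t y = 0.
  move=> tI Dy.
  have q24 : (2 <= 4)%N by [].
  have a0 := agree_inside0 UD dvP duP.
  have agree k a : (2 * k + mdeg a <= 2)%N -> agree_inside T U dv du k a ->
      dv k a t y = du k a t y.
    by move=> ka H; exact: (agree_closure hT oU UD cU DclU Ux0 dvP duP q24 ka H tI Dy).
  have a1 i : agree_inside T U dv du 0 (mincr (mindex0 d) i).
    by apply: (agree_inside_space oU UD dvP duP q24) => //; rewrite mdeg_mindex0.
  have a2 i j : agree_inside T U dv du 0 (mincr (mincr (mindex0 d) i) j).
    by apply: (agree_inside_space oU UD dvP duP q24) => //; rewrite mdeg_mincr mdeg_mindex0.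
  have at1 : agree_inside T U dv du 1 (mindex0 d).
    by apply: (agree_inside_time oU UD dvP duP q24) => //; rewrite mdeg_mindex0.
  rewrite (agree _ _ _ at1) ?mdeg_mindex0// (@generator_eq _ _ _ _ _ _ du).
  - exact: pdeu.
  - by move=> i; apply: agree => //; rewrite mdeg_mincr mdeg_mindex0.
  - by move=> i j; apply: agree => //; rewrite !mdeg_mincr mdeg_mindex0.
have EY : ('E_(sde_prob Y)[(fun w => f (sde_Y Y T w))] = (u 0 y0)%:E)%E.
  have X0 := hX _ _ OT hy0.
  rewrite (same_law_terminal_mean (ltW hT) f_borel bD OT hY X0 (huniq _ _ OT hy0 _ _ hY X0)).
  rewrite /u /value_function fineK// unlock.
  exact: (integrable_fin_num measurableT (hf _ _ OT hy0)).
have [hb1 hb1_gt0 [fh [gh [jh [cond [p [C1 [p_gt1 C1_gt0 small]]]]]]]] := hA1.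
have [hb2 hb2_gt0 mom] := hA2.
(* one moment bound for each exponent n + 2, which is larger than 1 *)
have mom' (n : nat) : exists c, 0 < c /\ forall N, (0 < N)%N -> T / N%:R < hb2 ->
      (forall k, (k <= N)%N -> (Lp_norm n.+2%:R (ch_Y (Yh N) k) <= c%:E)%E) /\
      (forall k, (k < N)%N ->
         (((Num.sqrt (T / N%:R))^-1)%:E * Lp_norm n.+2%:R (@increment _ _ (Yh N) k)
            <= c%:E)%E).
  have n1 : 1 < n.+2%:R :> R by rewrite ltr1n.
  by have [c c_gt0 H] := mom _ n1; exists c.
have {mom'} [cM HcM] := choice mom'.
pose M n := weight_mean (cM n) n.
pose L4 := cM 2%N ^+ 4.
pose L8 := cM 6%N ^+ 8.
pose K := C * (1 + d%:R ^+ 2 + d%:R ^+ 4).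
have K_ge0 : 0 <= K by rewrite mulr_ge0// !addr_ge0// exprn_ge0.
pose err := bias_const d Cmu mmu T C m p C1 M + remainder_const K m M L4 L8.
exists (Num.min hb1 hb2); first by rewrite lt_min hb1_gt0.
(* adding 1 makes the constant positive whatever the moment bounds are *)
exists (`|err| + 1); first by rewrite ltr_wpDl.
move=> N N_gt0; rewrite lt_min => /andP[Nhb1 Nhb2].
set h := T / N%:R in Nhb1 Nhb2 *.
have N0 : 0 < N%:R :> R by rewrite ltr0n.
have h_gt0 : 0 < h by rewrite divr_gt0.
have h_le : h <= T by rewrite ler_pdivrMr// ler_peMr ?ler1n// ltW.
have NhT : N%:R * h = T by rewrite mulrC divfK// lt0r_neq0.
set P := ch_prob (Yh N).
have [chm chS _] := hYh _ N_gt0.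
have chD n w : (n <= N)%N -> D (ch_Y (Yh N) n w).
  by move=> nN; apply: (hS _ _ N_gt0 nN); exact: chS.
have weightM n k : (n <= N)%N -> mean_le P (fun w => weight k (ch_Y (Yh N) n w)) (M k).
  move=> nN; have [cMk H] := HcM k; apply: weight_moment; first exact: chm.
    exact: ltW.
  by have [Hn _] := H N N_gt0 Nhb2; exact: Hn.
have incr_mean n k : (n < N)%N ->
    mean_le P (fun w => enorm (increment n w) ^+ k.+2) ((cM k * Num.sqrt h) ^+ k.+2).
  move=> nN; have [cMk H] := HcM k.
  have s0 : 0 < Num.sqrt h by rewrite sqrtr_gt0.
  apply: Lnorm_moment_nat => //.
  - by rewrite mulr_ge0// ltW.
  - exact: (dY_measurable (chm _ (ltnW nN)) (chm _ nN)).
  - by move=> w; exact: enorm_ge0.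
  - have [_ /(_ n nN)] := H N N_gt0 Nhb2.
    by rewrite lee_pdivrMl// muleC -EFinM mulrC.
pose a n := \int[P]_w u (n%:R * h) (ch_Y (Yh N) n w).
have tI n : (n < N)%N -> 0 <= n%:R * h < T.
  by move=> nN; rewrite mulr_ge0 ?(ltW h_gt0)//= -NhT ltr_pM2r// ltr_nat.
have tI' n : (n <= N)%N -> 0 <= n%:R * h <= T.
  by move=> nN; rewrite mulr_ge0 ?(ltW h_gt0)//= -NhT ler_pM2r// ler_nat.
have local n : (n < N)%N -> `|a n.+1 - a n| <= h ^+ 2 * err.
  move=> nN.
  have [cond1 cond2 cond3] := cond N n N_gt0 nN Nhb1.
  have [smallF smallG smallJ] := small N n N_gt0 (ltnW nN) (ltW Nhb1).
  have tIn := tI _ nN; have tIn' := tI' _ nN; have /andP[t0 tT] := tIn.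
  have hE : n.+1%:R * h - n%:R * h = h by rewrite -natr1 mulrDl mul1r addrAC subrr add0r.
  have i4 := incr_mean n 2%N nN; have i8 := incr_mean n 6%N nN.
  have s4 : (cM 2%N * Num.sqrt h) ^+ 4 = L4 * h ^+ 2.
    by rewrite exprMn (_ : 4 = 2 * 2)%N// (exprM (Num.sqrt h)) sqr_sqrtr// ltW.
  have s8 : (cM 6%N * Num.sqrt h) ^+ 8 = L8 * h ^+ 4.
    by rewrite exprMn (_ : 8 = 2 * 4)%N// (exprM (Num.sqrt h)) sqr_sqrtr// ltW.
  rewrite s4 in i4; rewrite s8 in i8.
  apply: (@local_error _ _ _ P d l D bD mu sigma hmu_meas hsigma_meas Cmu mmu mu_growth
    dv (n%:R * h) h T C K m h_gt0 h_le C_ge0 K_ge0 Cmu_ge0 _ _ _ (u (n.+1%:R * h)) (u (n%:R * h))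
    (uB _ tIn') (uB _ (tI' _ (ltnW nN))) _ _ _ (ch_Y (Yh N) n) (ch_Y (Yh N) n.+1)
    (chm _ (ltnW nN)) (chm _ nN) _ _ (fh h) (gh h) (jh h) cond1 cond2 cond3
    p C1 p_gt1 (ltW C1_gt0) smallF smallG smallJ M L4 L8 _ _ i4 i8).
  - by move=> k b kb; exact: (dv_borel_space bD dvP kb tIn).
  - by move=> k b kb y Dy; exact: bdv.
  - by move=> y Dy; exact: pde.
  - by move=> y; exact: uG.
  - by move=> y; apply: uG; exact: tI' (ltnW nN).
  - move=> y y' Dy Dy'.
    have lth : n%:R * h < n.+1%:R * h by rewrite ltr_pM2r// ltr_nat.
    have /andP[_ sT] := tIn'.
    have := taylor_step_bound hT oU UD cU DclU Ux0 dvP bdv erefl t0 lth sT Dy Dy' (uT _ Dy').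
    by rewrite hE.
  - by move=> w; exact/chD/ltnW.
  - by move=> w; exact: chD.
  - by move=> k; exact/weightM/ltnW.
  - by move=> k; exact: weightM.
have glob := telescope_bound local.
have fN : (fun w => f (ch_Y (Yh N) N w)) = (fun w => u (N%:R * h) (ch_Y (Yh N) N w)).
  by apply/funext => w; rewrite NhT; have [-> _] := uTf _ (chD N w (leqnn N)).
have rN : P.-integrable setT (EFin \o (fun w => u (N%:R * h) (ch_Y (Yh N) N w))).
  apply: (rv_le (g := fun w => C * weight m (ch_Y (Yh N) N w))).
  - exact: (random_vector_comp (chm _ (leqnn N)) (uB _ (tI' _ (leqnn N))) (fun w => chD N w (leqnn N))).
  - by move=> w; apply: uG; [exact: tI'|exact: chD].
  - exact: mean_le_rv (mean_leZ C_ge0 (weightM _ _ (leqnn N))).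
have EN : ('E_P[(fun w => f (ch_Y (Yh N) N w))] = (a N)%:E)%E.
  by rewrite fN unlock /a fineK//; exact: integrable_fin_num.
have a0 : a 0%N = u 0 y0.
  rewrite /a mul0r.
  under eq_Rintegral => w _ do rewrite hYh0//.
  rewrite Rintegral_cst// -[RHS]mulr1; congr (_ * _).
  exact: (congr1 fine (@probability_setT _ _ _ P)).
rewrite EN EY -a0 lee_fin; apply: le_trans glob _.
have -> : (`|err| + 1) * T * h = N%:R * (h ^+ 2 * (`|err| + 1)).
  by rewrite -NhT; ring.
rewrite ler_wpM2l// ler_wpM2l ?exprn_ge0 ?(ltW h_gt0)//.
by rewrite (le_trans (ler_norm _))// lerDl.
Qed.
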